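(* Let $P\subset\mathbb{R}^n$ be an edge-simple polytope of dimension $n>2$ with facets $F_1,\dots,F_m$ and vertices $v_1,\dots,v_k$, let $\lambda$ be an isotropy function of $P$, and let $Q_P\subset P$ be the simple polytope obtained by cutting off the vertices of $P$, with facets $F_i'=F_i\cap Q_P$ ($1\le i\le m$) and $P_{H_j}$ ($1\le j\le k$). Define $\eta$ from the set of facets of $Q_P$ to $\mathbb{Z}^n/\mathbb{Z}_2$ by $$\eta(P_{H_j})=[(0,\dots,0,1)]\ (1\le j\le k),\qquad \eta(F_i')=[(\lambda(F_i),0)]\ (1\le i\le m).$$ Then $\eta$ is a characteristic function on $Q_P$, and $W(Q_P,\lambda)$ is (homeomorphic to) the orbit space of the action on the quasitoric manifold $M(Q_P,\eta)$ of the circle subgroup $\mathbb{T}_H\subset\mathbb{T}^n$ determined by the submodule $\{0\}\times\dots\times\{0\}\times\mathbb{Z}$ of $\mathbb{Z}^n$.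
   Context: An $n$-dimensional convex polytope $P$ is edge-simple if each edge of $P$ is the intersection of exactly $n-1$ facets of $P$ (facets are codimension-one faces). In an edge-simple $n$-polytope every face of codimension $l<n$ is the intersection of a unique set of $l$ facets. A simple $n$-polytope is a convex $n$-polytope in which exactly $n$ facets meet at each vertex. $\mathbb{T}^{m}=U(1)^m=(\mathbb{Z}^m\otimes\mathbb{R})/\mathbb{Z}^m$; $\mathbb{Z}^{m}/\mathbb{Z}_2$ is the quotient of $\mathbb{Z}^m$ by $x\sim\pm x$, and $[x]$ is the class of $x$. An isotropy function of an edge-simple $n$-polytope $P$ is a map $\lambda$ from the set of facets of $P$ to $\mathbb{Z}^{n-1}/\mathbb{Z}_2$ such that $\lambda(F_{i_1}),\dots,\lambda(F_{i_{n-1}})$ form a basis of $\mathbb{Z}^{n-1}$ whenever the intersection of the facets $F_{i_1},\dots,F_{i_{n-1}}$ is an edge of $P$. $Q_P$: for each vertex $v_i$ cut off a neighbourhood of $v_i$ in $P$ by an affine hyperplane $H_i$ of $\mathbb{R}^n$ (separating $v_i$ from the other vertices), with $H_i\cap H_j\cap P=\emptyset$ for $i\neq j$. The remaining subset of $P$ is a simple $n$-polytope $Q_P$, and $P_{H_i}=P\cap H_i$. $W(Q_P,\lambda)$: for a face $F=F_{i_1}\cap\dots\cap F_{i_l}$ of $P$ of codimension $l<n$ let $\mathbb{T}_F\subset\mathbb{T}^{n-1}$ be the subtorus corresponding to the submodule of $\mathbb{Z}^{n-1}$ generated by $\lambda(F_{i_1}),\dots,\lambda(F_{i_l})$. Then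 $W(Q_P,\lambda)=(\mathbb{T}^{n-1}\times Q_P)/\sim$ (quotient topology), where $(t,p)\sim(u,q)$ iff $p=q$ and $tu^{-1}\in\mathbb{T}_F$, with $F$ the unique face of $P$ containing $p$ in its relative interior. A characteristic function on a simple $n$-polytope $Q$ is a map $\eta$ from its facets to $\mathbb{Z}^n/\mathbb{Z}_2$ such that whenever facets $G_1,\dots,G_l$ of $Q$ have nonempty intersection, $\eta(G_1),\dots,\eta(G_l)$ generate an $l$-dimensional direct summand of $\mathbb{Z}^n$. The associated quasitoric manifold is $M(Q,\eta)=(\mathbb{T}^n\times Q)/\sim$, where $(t,p)\sim(u,q)$ iff $p=q$ and $tu^{-1}$ lies in the subtorus of $\mathbb{T}^n$ corresponding to the submodule generated by the $\eta(G)$, $G$ running over facets of $Q$ containing $p$; $\mathbb{T}^n$ acts by multiplication on the first factor. *)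

(* Defs.v *)
From HB Require Import structures.
From Stdlib Require Import Relation_Operators.
From mathcomp Require Import all_boot all_order all_algebra.
From mathcomp Require Import all_classical all_reals all_analysis.
Import Order.TTheory GRing.Theory Num.Theory.
Import numFieldNormedType.Exports.

Set Implicit Arguments.
Unset Strict Implicit.
Unset Printing Implicit Defensive.

Local Open Scope classical_set_scope.
Local Open Scope ring_scope.
Local Open Scope quotient_scope.
Local Open Scope card_scope.

Section Polytopes.
Context {R : realType} {n : nat}.
Local Notation V := 'rV[R]_n.
Implicit Types (A P F G E : set V) (x v : V).

Definition dot (a x : V) : R := \sum_(i < n) a 0 i * x 0 i.

(* A pair (a, b) stands for the oriented affine hyperplane <a, x> = b. *)
Definition hyperplane (h : V * R) : set V := [set x | dot h.1 x = h.2].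
Definition halfspace (h : V * R) : set V := [set x | dot h.1 x <= h.2].

Definition affine_hull A : set V :=
  [set x | forall (x0 : V) (U : {vspace V}),
     (forall y, A y -> y - x0 \in U) -> x - x0 \in U].

Definition has_dim A (d : nat) : Prop :=
  exists (x0 : V) (U : {vspace V}),
    affine_hull A = [set x | x - x0 \in U] /\ \dim U = d.

Definition relint A : set V :=
  [set x | A x /\ \forall y \near x, affine_hull A y -> A y].

Definition polytope P : Prop :=
  bounded_set P /\
  exists s : seq (V * R), P = [set x | forall h, h \in s -> halfspace h x].

(* Nonempty faces only; h = (0, 0) gives the improper face P. *)
Definition face P F : Prop :=
  F !=set0 /\
  exists h : V * R, P `<=` halfspace h /\ F = P `&` hyperplane h.

Definition vertex P v : Prop := face P [set v].
Definition edge P E : Prop := face P E /\ has_dim E 1.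
Definition facet P F : Prop := face P F /\ has_dim F n.-1.

Definition edge_simple P : Prop :=
  [/\ polytope P, has_dim P n
    & forall E, edge P E ->
        [set F | facet P F /\ E `<=` F] #= `I_n.-1 /\
        E = \bigcap_(F in [set F | facet P F /\ E `<=` F]) F].

Definition simple_polytope P : Prop :=
  [/\ polytope P, has_dim P n
    & forall v, vertex P v -> [set F | facet P F /\ F v] #= `I_n].

(* H v is the hyperplane cutting off v, oriented so that v lies outside its
   half-space; the values of H at points that are not vertices are unused. *)
Definition vertex_cut P (H : V -> V * R) : Prop :=
  (forall v, vertex P v ->
     [/\ (H v).1 != 0, (H v).2 < dot (H v).1 v
       & forall w, vertex P w -> w <> v -> dot (H v).1 w < (H v).2]) /\
  (forall v w, vertex P v -> vertex P w -> v <> w ->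
     hyperplane (H v) `&` hyperplane (H w) `&` P = set0).

Definition cut_polytope P (H : V -> V * R) : set V :=
  P `&` [set x | forall v, vertex P v -> halfspace (H v) x].

End Polytopes.

Section Lattice.
Variable m : nat.
Local Notation Z := 'rV[int]_m.

Definition sign_rel : rel Z := fun x y => (x == y) || (x == - y).

Lemma sign_rel_refl : reflexive sign_rel.
Proof. by move=> x; rewrite /sign_rel eqxx. Qed.

Lemma sign_rel_sym : symmetric sign_rel.
Proof. by move=> x y; rewrite /sign_rel eq_sym -eqr_oppLR (eq_sym (- x)). Qed.

Lemma sign_rel_trans : transitive sign_rel.
Proof.
move=> y x z; rewrite /sign_rel => /orP[]/eqP-> // /orP[]/eqP->.
  by rewrite eqxx orbT.
by rewrite opprK eqxx.
Qed.

Definition sign_equiv : equiv_rel Z :=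
  EquivRel sign_rel sign_rel_refl sign_rel_sym sign_rel_trans.

(* Z^m / Z_2.  Below, repr picks one of the two representatives of a class;
   spans, bases and summands do not depend on that choice of sign. *)
Definition zpm : Type := {eq_quot sign_equiv}.
HB.instance Definition _ := Choice.on zpm.
HB.instance Definition _ := EqQuotient.on zpm.

Lemma zpm_eqP x y : \pi_zpm x = \pi_zpm y <-> x = y \/ x = - y.
Proof.
split=> [/eqmodP/orP[]/eqP|xy]; [by left|by right|].
by apply/eqmodP/orP; case: xy => ->; [left|right].
Qed.

Definition zspan (A : set Z) : set Z :=
  [set x | exists (l : nat) (v : 'I_l -> Z) (c : 'rV[int]_l),
     (forall i, A (v i)) /\ x = \sum_(i < l) c 0 i *: v i].

Definition submodule (S : set Z) : Prop :=
  S 0 /\ forall x y, S x -> S y -> S (x - y).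

Definition has_zbasis (S : set Z) (l : nat) (v : 'I_l -> Z) : Prop :=
  (forall i, S (v i)) /\
  forall x, S x -> exists! c : 'rV[int]_l, x = \sum_(i < l) c 0 i *: v i.

Definition direct_summand (S : set Z) (l : nat) : Prop :=
  [/\ submodule S, exists v : 'I_l -> Z, has_zbasis S v
    & exists N : set Z, submodule N /\
        forall x, exists! p : Z * Z, [/\ S p.1, N p.2 & x = p.1 + p.2]].

End Lattice.

(* (x, 0) in Z^(n-1) x Z = Z^n *)
Definition append0 n (x : 'rV[int]_n.-1) : 'rV[int]_n :=
  \row_(i < n) (if insub (i : nat) is Some j then x 0 j else 0).

Definition zpm_append0 n (c : zpm n.-1) : zpm n :=
  \pi_(zpm n) (append0 (repr c)).

Lemma zpm_append0E n (x : 'rV[int]_n.-1) :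
  zpm_append0 (\pi_(zpm n.-1) x) = \pi_(zpm n) (append0 x).
Proof.
apply/zpm_eqP; have /zpm_eqP[->|->] := reprK (\pi_(zpm n.-1) x); first by left.
right; apply/rowP=> i; rewrite !mxE; case: insub => [j|]; last by rewrite oppr0.
by rewrite mxE.
Qed.

(* (0, ..., 0, 1) *)
Definition e_last n : 'rV[int]_n := \row_(i < n) (i == n.-1 :> nat)%:R.

(* {0} x ... x {0} x Z *)
Definition last_axis n : set 'rV[int]_n :=
  [set x | forall i : 'I_n, (i < n.-1)%N -> x 0 i = 0].

Section Torus.
Variables (R : realType) (m : nat).

Definition int_vec : {pred 'rV[R]_m} := [pred x | x \is a mxOver Num.int].

Lemma int_vec_zmod_closed : zmod_closed int_vec.
Proof.
split=> [|x y]; first by rewrite inE; apply/mxOverP=> i j; rewrite mxE rpred0.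
rewrite !inE => /mxOverP xZ /mxOverP yZ.
by apply/mxOverP=> i j; rewrite !mxE rpredB.
Qed.
HB.instance Definition _ := GRing.isZmodClosed.Build _ int_vec int_vec_zmod_closed.

(* R^m / Z^m, written additively. *)
Definition torus : Type := quotient_topology {ideal_quot int_vec}.
HB.instance Definition _ := Topological.on torus.
HB.instance Definition _ := Quotient.on torus.
HB.instance Definition _ := GRing.isZmodule.Build torus
  (@addrA {ideal_quot int_vec}) (@addrC {ideal_quot int_vec})
  (@add0r {ideal_quot int_vec}) (@addNr {ideal_quot int_vec}).

Lemma pi_torusD : {morph \pi_torus : x y / x + y}.
Proof. 
move=> x y. rewrite unlock. 
by move: (@pi_addr _ _ _ _ _ {ideal_quot int_vec} x y); rewrite unlock.
Qed.

Lemma pi_torus_eq x y :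
  \pi_torus x = \pi_torus y <-> x - y \is a mxOver Num.int.
Proof.
have /= -> : (x - y \is a mxOver Num.int) = (x - y \in int_vec) by rewrite inE.
by rewrite Quotient.idealrBE unlock; split=> [->|/eqP].
Qed.

(* The image in R^m / Z^m of the real span of S. *)
Definition subtorus (S : set 'rV[int]_m) : set torus :=
  [set t | exists (l : nat) (v : 'I_l -> 'rV[int]_m) (c : 'rV[R]_l),
     (forall i, S (v i)) /\
     t = \pi_torus (\sum_(i < l) c 0 i *: map_mx intr (v i))].
End Torus.

Section QuotientSpace.
Variables (X : topologicalType) (r : X -> X -> Prop).

Let e : rel X := fun x y => `[< clos_refl_sym_trans X r x y >].

Let e_refl : reflexive e.
Proof. by move=> x; apply/asboolP; exact: rst_refl. Qed.

Let e_sym : symmetric e.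
Proof. by move=> x y; apply/asbool_equiv_eq; split; exact: rst_sym. Qed.

Let e_trans : transitive e.
Proof.
by move=> y x z /asboolP xy /asboolP yz; apply/asboolP; exact: rst_trans xy yz.
Qed.

Definition gen_equiv : equiv_rel X := EquivRel e e_refl e_sym e_trans.

(* X / r with the quotient topology.  Passing to the equivalence relation
   generated by r changes nothing when r already is one. *)
Definition quot_space : Type := quotient_topology {eq_quot gen_equiv}.
HB.instance Definition _ := Topological.on quot_space.
HB.instance Definition _ := Quotient.on quot_space.

Lemma quot_space_eqP x y :
  \pi_quot_space x = \pi_quot_space y <-> clos_refl_sym_trans X r x y.
Proof.
split=> [/(@eqmodP X gen_equiv)/asboolP //|xy].
by apply/(@eqmodP X gen_equiv)/asboolP.
Qed.

End QuotientSpace.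

Definition homeomorphic (X Y : topologicalType) : Prop :=
  exists (f : X -> Y) (g : Y -> X),
    [/\ continuous f, continuous g, cancel f g & cancel g f].

Section ToricSpaces.
Context {R : realType} {n : nat}.
Local Notation V := 'rV[R]_n.

(* Functions on the set of facets are total functions on sets of points, of
   which only the values at facets matter. *)
Definition isotropy_function (P : set V) (lambda : set V -> zpm n.-1) : Prop :=
  forall Fs : 'I_n.-1 -> set V, injective Fs -> (forall i, facet P (Fs i)) ->
    edge P (\bigcap_i Fs i) ->
    has_zbasis setT (fun i => repr (lambda (Fs i))).

Definition characteristic_function (Q : set V) (eta : set V -> zpm n) : Prop :=
  forall (l : nat) (G : 'I_l -> set V), injective G ->
    (forall i, facet Q (G i)) -> \bigcap_i G i !=set0 ->
    direct_summand (zspan (range (fun i => repr (eta (G i))))) l.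

(* T_F; intersecting with P accounts for l = 0, where F = P. *)
Definition face_torus (P : set V) (lambda : set V -> zpm n.-1) (F : set V) :
    set (torus R n.-1) :=
  [set t | exists (l : nat) (Fs : 'I_l -> set V),
     [/\ (l < n)%N, injective Fs, forall i, facet P (Fs i),
         F = P `&` \bigcap_i Fs i /\ has_dim F (n - l)
       & subtorus (zspan (range (fun i => repr (lambda (Fs i))))) t]].

Definition W_rel (P Q : set V) (lambda : set V -> zpm n.-1) :
    (torus R n.-1 * Q)%type -> (torus R n.-1 * Q)%type -> Prop :=
  fun x y => x.2 = y.2 /\
    exists F, [/\ face P F, relint F (\val x.2)
                & face_torus P lambda F (x.1 - y.1)].

Definition W_space (P Q : set V) (lambda : set V -> zpm n.-1) :
    topologicalType :=
  quot_space (@W_rel P Q lambda).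

Definition M_rel (Q : set V) (eta : set V -> zpm n) :
    (torus R n * Q)%type -> (torus R n * Q)%type -> Prop :=
  fun x y => x.2 = y.2 /\
    subtorus (zspan [set repr (eta G) | G in
                       [set G | facet Q G /\ G (\val x.2)]]) (x.1 - y.1).

Definition quasitoric (Q : set V) (eta : set V -> zpm n) : topologicalType :=
  quot_space (@M_rel Q eta).

Definition quasitoric_class (Q : set V) (eta : set V -> zpm n)
    (t : torus R n) (p : Q) : quasitoric Q eta :=
  \pi_(quot_space (@M_rel Q eta)) (t, p).

Definition quasitoric_act (Q : set V) (eta : set V -> zpm n)
    (s : torus R n) (x : quasitoric Q eta) : quasitoric Q eta :=
  let tp := repr (x : quot_space (@M_rel Q eta)) in
  quasitoric_class eta (s + tp.1) tp.2.

Lemma quasitoric_actE (Q : set V) (eta : set V -> zpm n) s t (p : Q) :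
  quasitoric_act s (quasitoric_class eta t p) = quasitoric_class eta (s + t) p.
Proof.
have tr x y : clos_refl_sym_trans _ (@M_rel Q eta) x y ->
    clos_refl_sym_trans _ (@M_rel Q eta) (s + x.1, x.2) (s + y.1, y.2).
  elim=> {x y}[x y [xy2 xy]|x|x y _|x y z _ xy _ yz].
  - by apply: rst_step; split => //=; rewrite opprD addrACA subrr add0r.
  - exact: rst_refl.
  - exact: rst_sym.
  - exact: rst_trans xy yz.
rewrite /quasitoric_act; apply/quot_space_eqP/(tr _ (t, p))/quot_space_eqP.
exact: reprK.
Qed.

Definition quasitoric_orbit_space (Q : set V) (eta : set V -> zpm n)
    (S : set (torus R n)) : topologicalType :=
  quot_space (fun x y : quasitoric Q eta =>
                exists s, S s /\ y = quasitoric_act s x).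

(* T_H *)
Definition last_circle : set (torus R n) := subtorus (@last_axis n).

End ToricSpaces.

(* Main.v *)
Require Import Defs.
From Stdlib Require Import Relation_Operators.
From mathcomp Require Import all_boot all_order all_algebra.
From mathcomp Require Import all_classical all_reals all_analysis.
From mathcomp Require Import zify ring lra.
Import Order.TTheory GRing.Theory Num.Theory.
Import numFieldNormedType.Exports.

Set Implicit Arguments.
Unset Strict Implicit.
Unset Printing Implicit Defensive.

Local Open Scope classical_set_scope.
Local Open Scope ring_scope.
Local Open Scope quotient_scope.
Local Open Scope card_scope.

(** Describe P by an irredundant system of inequalities: its facets are then in
bijection with the inequalities, and the minimal face through a point is given
by the active ones.  The cuts are pairwise disjoint in P, so adding them keeps
the system irredundant, which yields the facets of Q.  A vertex of Q lies in the
relative interior of an edge E of P and on one cut, hence on the n - 1 facets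
through E and on one cut facet; by the isotropy condition the corresponding
values of eta form a basis of Z^n, and every nonempty intersection of facets of
Q contains a vertex.  Finally T^n -> T^(n-1), with section t |-> (t, 0), carries
the relation defining M(Q, eta) to the one defining W(Q, lambda), its kernel is
T_H, and the two maps descend to mutually inverse continuous maps. *)

(** Two gaps shape the argument. The cutting hyperplanes are only assumed not to meet inside P,
    whereas the facets of Q require that no point of P lies on or beyond two cuts; convexity and a
    third vertex bridge this in [cut_disjoint]. Moreover, edge-simplicity says nothing at the
    vertices of P, where more than n facets may meet. The relation between the number of active
    inequalities and the dimension of the face is therefore obtained from edges, at points that are
    not vertices; this covers all of Q, because each vertex of P is cut off. Faces are handled
    through points: each one consists of the points of P where the inequalities active at a suitable
    point are equalities, so its dimension is that of a common kernel of linear forms. *)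

Lemma seq_argmin (T : eqType) (R : realDomainType) (s : seq T) (f : T -> R) :
  s != [::] -> exists2 h, h \in s & forall h', h' \in s -> f h <= f h'.
Proof.
elim: s => [//|a [|b s] IH] _.
  by exists a; rewrite ?mem_head// => h'; rewrite inE => /eqP->.
have [//|h hs hmin] := IH; have [fa|fa] := leP (f a) (f h).
  exists a; rewrite ?mem_head// => h'; rewrite inE => /orP[/eqP->//|/hmin].
  exact: le_trans.
exists h; first by rewrite inE hs orbT.
by move=> h'; rewrite inE => /orP[/eqP->|/hmin//]; exact: ltW.
Qed.

Lemma card_seq (T : eqType) (s : seq T) (U : Type) (f : T -> U) :
  uniq s -> {in s &, injective f} -> (f @` [set` s]) #= `I_(size s).
Proof.
case: s => [|x0 s']; first by rewrite set_nil image_set0 II0.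
move: (_ :: _) => {s'} s us inj.
have injf : {in `I_(size s) &, injective (fun i => f (nth x0 s i))}.
  move=> i j; rewrite !inE /= => li lj /inj; rewrite !mem_nth// => /(_ isT isT).
  by move/eqP; rewrite nth_uniq// => /eqP.
have -> : f @` [set` s] = (fun i => f (nth x0 s i)) @` `I_(size s).
  apply/seteqP; split=> [_ [x /= xs <-]|_ [i /= li <-]]; last first.
    by exists (nth x0 s i) => //=; rewrite mem_nth.
  by exists (index x s); rewrite /= ?index_mem ?nth_index.
exact: inj_card_eq.
Qed.

(** * Linear forms and their common kernels *)

Section LinearForms.
Context {R : realType} {n : nat}.
Local Notation V := 'rV[R]_n.
Implicit Types (a x y d : V) (s : seq (V * R)) (h : V * R).

Lemma dot_mulmx a x : dot a x = (x *m a^T) 0 0.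
Proof. by rewrite mxE; apply: eq_bigr => i _; rewrite mxE mulrC. Qed.

Lemma dotC a x : dot a x = dot x a.
Proof. by apply: eq_bigr => i _; rewrite mulrC. Qed.

Lemma dotDr a x y : dot a (x + y) = dot a x + dot a y.
Proof. by rewrite !dot_mulmx mulmxDl mxE. Qed.

Lemma dotZr a t x : dot a (t *: x) = t * dot a x.
Proof. by rewrite !dot_mulmx -scalemxAl mxE. Qed.

Lemma dot0r a : dot a 0 = 0.
Proof. by rewrite dot_mulmx mul0mx mxE. Qed.

Lemma dotNr a x : dot a (- x) = - dot a x.
Proof. by rewrite -scaleN1r dotZr mulN1r. Qed.

Lemma dotBr a x y : dot a (x - y) = dot a x - dot a y.
Proof. by rewrite dotDr dotNr. Qed.

Lemma dot0l x : dot 0 x = 0.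
Proof. by rewrite dotC dot0r. Qed.

Lemma dotNl a x : dot (- a) x = - dot a x.
Proof. by rewrite dotC dotNr dotC. Qed.

Lemma dotDl a a' x : dot (a + a') x = dot a x + dot a' x.
Proof. by rewrite dotC dotDr !(dotC x). Qed.

Lemma dot_self_gt0 a : a != 0 -> 0 < dot a a.
Proof.
move=> a0; rewrite lt_neqAle sumr_ge0 ?andbT; last first.
  by move=> i _; rewrite -expr2 sqr_ge0.
apply: contra a0; rewrite eq_sym psumr_eq0; last first.
  by move=> i _; rewrite -expr2 sqr_ge0.
move=> /allP a0; apply/eqP/rowP=> i; rewrite mxE.
by have := a0 i (mem_index_enum _); rewrite mulf_eq0 orbb => /eqP.
Qed.

Lemma continuous_dot a : continuous (dot a : V -> R).
Proof.
rewrite /dot; elim: (index_enum _) => [|i r IH] x.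
  rewrite (_ : (fun _ => _) = cst 0); first exact: cst_continuous.
  by apply/funext => y; rewrite big_nil.
rewrite (_ : (fun _ => _) =
    fun y : V => a 0 i * y 0 i + \sum_(j <- r) a 0 j * y 0 j).
  apply: cvgD (IH x); apply: cvgM; [exact: cvg_cst|exact: coord_continuous].
by apply/funext => y; rewrite big_cons.
Qed.

Definition dot_ker a : {vspace V} := lker (linfun (mulmxr a^T)).

Lemma mem_dot_ker a x : (x \in dot_ker a) = (dot a x == 0).
Proof.
rewrite memv_ker lfunE /= dot_mulmx; apply/eqP/eqP=> [->|x0]; first by rewrite mxE.
by apply/rowP => i; rewrite (ord1 i) x0 mxE.
Qed.

(** The direction space common to the hyperplanes of [s]; the constant terms play no part in it. *)
Definition lin s : {vspace V} := (\bigcap_(h <- s) dot_ker h.1)%VS.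

Lemma linP s x : reflect {in s, forall h, dot h.1 x = 0} (x \in lin s).
Proof.
rewrite /lin; elim: s => [|h s IH].
  by rewrite big_nil memvf; constructor.
rewrite big_cons memv_cap mem_dot_ker; apply: (iffP andP) => [[/eqP hx /IH sx]|sx].
  by move=> k; rewrite inE => /orP[/eqP->|/sx].
split; first by rewrite sx ?mem_head.
by apply/IH => k ks; rewrite sx// inE ks orbT.
Qed.

Lemma lin_subset s s' : {subset s <= s'} -> (lin s' <= lin s)%VS.
Proof.
move=> ss; apply/subvP => x /linP xs; apply/linP => h hs; exact/xs/ss.
Qed.

Lemma lin_eq_mem s s' : s =i s' -> lin s = lin s'.
Proof.
move=> ss; apply/eqP; rewrite eqEsubv !lin_subset// => h; by rewrite ss.
Qed.

(** By rank-nullity, each further form lowers the dimension of the common kernel by at most one. *)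
Lemma dim_lin_cat s s' : (\dim (lin s) <= \dim (lin (s ++ s')) + size s')%N.
Proof.
elim: s' s => [|h s' IH] s; first by rewrite cats0 addn0.
rewrite -cat_rcons /= addnS -addSn.
apply: (@leq_trans (\dim (lin (rcons s h))).+1); last by rewrite addSn ltnS.
have -> : lin (rcons s h) = (lin s :&: dot_ker h.1)%VS.
  by rewrite /lin -cats1 big_cat big_seq1.
rewrite -(limg_ker_dim (linfun (mulmxr (h.1)^T)) (lin s)) -[leqRHS]addn1 leq_add2l.
by apply: leq_trans (dimvS (subvf _)) _; rewrite dimvf /dim /= mul1n.
Qed.

Lemma dim_lin_nil : \dim (lin [::]) = n.
Proof. by rewrite /lin big_nil dimvf /dim /= mul1n. Qed.

Lemma dim_lin_le s : (\dim (lin s) <= n)%N.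
Proof. by have := dimvS (subvf (lin s)); rewrite dimvf /dim /= mul1n. Qed.

Lemma dim_lin_ge s : (n <= \dim (lin s) + size s)%N.
Proof. by have := dim_lin_cat [::] s; rewrite dim_lin_nil. Qed.

(** A nonzero form is positive on its own coefficient vector, so it cannot vanish everywhere. *)
Lemma lin_full s : (n <= \dim (lin s))%N -> {in s, forall h, h.1 = 0}.
Proof.
move=> sn h hs; apply/eqP; apply: contraT => h0.
have /linP/(_ h hs) hh : h.1 \in lin s.
  have /eqP -> : lin s == fullv by rewrite eqEdim subvf dimvf /dim /= mul1n.
  by rewrite memvf.
by have := dot_self_gt0 h0; rewrite hh ltxx.
Qed.

Lemma dim_lin1 h : h.1 != 0 -> \dim (lin [:: h]) = n.-1.
Proof.
move=> h0; have := dim_lin_ge [:: h]; have := dim_lin_le [:: h].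
have : ~~ (n <= \dim (lin [:: h]))%N.
  by apply: contra h0 => /lin_full -> //; rewrite mem_head.
rewrite /=; lia.
Qed.

Lemma strict_eps s x d : {in s, forall h, dot h.1 x < h.2} ->
  exists2 e : R, 0 < e &
    forall t : R, `|t| <= e -> {in s, forall h, dot h.1 (x + t *: d) < h.2}.
Proof.
elim: s => [|h s IH] sx; first by exists 1.
have [|e e0 es] := IH; first by move=> k ks; rewrite sx// inE ks orbT.
have hx := sx h (mem_head _ _).
(* Slack divided by speed along [d]; the added 1 keeps the denominator positive and makes the final
   bound strict for nonzero [t]. *)
pose q := (h.2 - dot h.1 x) / (`|dot h.1 d| + 1).
have q0 : 0 < q by rewrite divr_gt0 ?subr_gt0// ltr_wpDl.
exists (Num.min e q) => [|t]; first by rewrite lt_min e0.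
rewrite le_min => /andP[te tq] k; rewrite inE => /orP[/eqP->|]; last exact: es.
rewrite dotDr dotZr -ltrBrDl (le_lt_trans (ler_norm _))// normrM.
have [->|t0] := eqVneq t 0; first by rewrite normr0 mul0r subr_gt0.
move: tq; rewrite /q ler_pdivlMr; last by rewrite ltr_wpDl.
move=> tq; apply: lt_le_trans tq.
by rewrite ltr_pM2l ?normr_gt0// ltrDl.
Qed.

Lemma strict_near s x : {in s, forall h, dot h.1 x < h.2} ->
  \forall y \near x, {in s, forall h, dot h.1 y < h.2}.
Proof.
elim: s => [|h s IH] sx; first by near=> y.
have near_s : \forall y \near x, {in s, forall h, dot h.1 y < h.2}.
  by apply: IH => k ks; rewrite sx// inE ks orbT.
have near_h : \forall y \near x, dot h.1 y < h.2.
  have := @continuous_dot h.1 x; move/cvgr_lt; apply.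
  by apply: sx; rewrite mem_head.
near=> y => k; rewrite inE => /orP[/eqP->|]; first by near: y.
by move: k; near: y.
Unshelve. all: by end_near. Qed.

End LinearForms.

(** * Faces of a polyhedron as minimal faces of points *)

Section Faces.
Context {R : realType} {n : nat}.
Local Notation V := 'rV[R]_n.
Implicit Types (a x y d : V) (s : seq (V * R)) (h : V * R) (A P F : set V).

Definition polyhedron s : set V := [set x | forall h, h \in s -> halfspace h x].

Definition tight s x := [seq h <- s | dot h.1 x == h.2].

(** For [x] in the polyhedron this is the smallest face containing [x]. Phrasing it by the direction
    [y - x] lets its affine hull and dimension be read off [lin]. *)
Definition min_face s x : set V :=
  [set y | polyhedron s y /\ y - x \in lin (tight s x)].

Lemma mem_tight s x h : (h \in tight s x) = (dot h.1 x == h.2) && (h \in s).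
Proof. by rewrite mem_filter. Qed.

Lemma tight_linP s x y :
  reflect {in tight s x, forall h, dot h.1 y = h.2} (y - x \in lin (tight s x)).
Proof.
apply: (iffP (linP _ _)) => xy h hx; have := xy h hx;
  move: hx; rewrite mem_tight dotBr => /andP[/eqP-> _].
  by move/eqP; rewrite subr_eq0 => /eqP.
by move=> ->; rewrite subrr.
Qed.

Lemma strict_or_tight s x h : polyhedron s x -> h \in s ->
  h \notin tight s x -> dot h.1 x < h.2.
Proof.
move=> Px hs; rewrite mem_tight hs andbT lt_neqAle => ->; exact: Px.
Qed.

(** Active constraints are constant along [d] and the others have slack, so a short move to either
    side keeps the active set. *)
Lemma lin_tight_eps s x d : polyhedron s x -> d \in lin (tight s x) ->
  exists2 e : R, 0 < e & forall t : R, `|t| <= e ->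
    polyhedron s (x + t *: d) /\ tight s (x + t *: d) = tight s x.
Proof.
move=> Px /linP dx.
have [h|e e0 es] := @strict_eps _ _ [seq h <- s | h \notin tight s x] x d.
  by rewrite mem_filter => /andP[hx hs]; exact: strict_or_tight hx.
exists e => // t te.
have xt h : h \in tight s x -> dot h.1 (x + t *: d) = h.2.
  move=> hx; rewrite dotDr dotZr dx// mulr0 addr0.
  by move: hx; rewrite mem_tight => /andP[/eqP].
have xs h : h \in s -> h \notin tight s x -> dot h.1 (x + t *: d) < h.2.
  by move=> hs hx; rewrite es// mem_filter hx.
split=> [h hs|].
  by have [/xt|/(xs _ hs)/ltW//] := boolP (h \in tight s x); rewrite /halfspace /= => ->.
apply: eq_in_filter => h hs; have [hx|hx] := boolP (h \in tight s x).
  by rewrite xt// eqxx; move: hx; rewrite mem_tight hs andbT => ->.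
rewrite (lt_eqF (xs _ hs hx)); move: hx; rewrite mem_tight hs andbT => /negPf->//.
Qed.

Lemma min_face_refl s x : polyhedron s x -> min_face s x x.
Proof. by move=> Px; split=> //; rewrite subrr mem0v. Qed.

(** The face contains a short segment from [x] in every direction of [lin (tight s x)], so no
    smaller affine subspace contains it. *)
Lemma affine_hull_min_face s x : polyhedron s x ->
  affine_hull (min_face s x) = [set y | y - x \in lin (tight s x)].
Proof.
move=> Px; apply/seteqP; split=> y /=; first by apply=> z [].
move=> yx x0 U FU; have [e e0 es] := lin_tight_eps Px yx.
have [] := es e; first by rewrite gtr0_norm.
move=> Pe te.
have xU : x - x0 \in U by apply/FU/min_face_refl.
have : e *: (y - x) \in U.
  rewrite -(addrK (x - x0) (e *: _)) memvB// addrCA addrA; apply: FU; split=> //.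
  by rewrite [X in X \in _]addrC addKr memvZ.
move=> /(memvZ e^-1); rewrite scalerA mulVf ?gt_eqF// scale1r => yxU.
by rewrite -(subrK x y) -addrA memvD.
Qed.

Lemma has_dim_min_face s x : polyhedron s x ->
  has_dim (min_face s x) (\dim (lin (tight s x))).
Proof. by move=> Px; exists x, (lin (tight s x)); rewrite affine_hull_min_face. Qed.

Lemma has_dim_uniq A (d d' : nat) : has_dim A d -> has_dim A d' -> d = d'.
Proof.
move=> [x [U [E1 <-]]] [y [W [+ <-]]]; rewrite {}E1 => E; congr (\dim _).
have mU z : (z - x \in U) = (z - y \in W).
  by move/seteqP: E => [E1 E2]; apply/idP/idP; [exact: E1|exact: E2].
have xyW : x - y \in W by rewrite -mU subrr mem0v.
apply/vspaceP => u; have := mU (u + x); rewrite addrK => ->.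
rewrite -addrA; apply/idP/idP=> uW; last exact: memvD.
by have := memvB uW xyW; rewrite addrK.
Qed.

Lemma relint_min_face s x : polyhedron s x -> relint (min_face s x) x.
Proof.
move=> Px; split; first exact: min_face_refl.
rewrite affine_hull_min_face//.
have : {in [seq h <- s | h \notin tight s x], forall h, dot h.1 x < h.2}.
  by move=> h; rewrite mem_filter => /andP[hx hs]; exact: strict_or_tight hx.
move/strict_near; apply: filterS => y ys /= yx; split=> // h hs.
have [hx|hx] := boolP (h \in tight s x).
  by rewrite /halfspace /= (tight_linP _ _ _ yx).
by apply: ltW; apply: ys; rewrite mem_filter hx.
Qed.

Lemma face_min_face s x : polyhedron s x -> face (polyhedron s) (min_face s x).
Proof.
move=> Px; split; first by exists x; exact: min_face_refl.
(* The supporting hyperplane is the sum of the active constraints: a sum of valid inequalities is an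
   equality exactly when each of them is. The empty sum gives the improper face. *)
have [H [H1 H2]] : exists H : V * R,
    (forall y, {in tight s x, forall h, halfspace h y} -> halfspace H y) /\
    (forall y, {in tight s x, forall h, halfspace h y} ->
      hyperplane H y <-> {in tight s x, forall h, dot h.1 y = h.2}).
  elim: (tight s x) => [|h l [H [H1 H2]]].
    by exists (0, 0); split=> y _; rewrite /halfspace /hyperplane /= dot0l.
  have lE y : {in h :: l, forall h, halfspace h y} -> {in l, forall h, halfspace h y}.
    by move=> yl k kl; apply: yl; rewrite inE kl orbT.
  have hE y : {in h :: l, forall h, halfspace h y} -> halfspace h y.
    by apply; rewrite mem_head.
  exists (h.1 + H.1, h.2 + H.2); split=> y yl.
    rewrite /halfspace /= dotDl lerD//; first exact: hE.
    exact/H1/lE.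
  have [h1 h2] := H2 _ (lE _ yl); have h3 := H1 _ (lE _ yl); have h4 := hE _ yl.
  rewrite /hyperplane /= dotDl; split.
    move: h3 h4; rewrite /halfspace /= => h3 h4 h5.
    have e1 : dot h.1 y = h.2 by lra.
    have e2 : dot H.1 y = H.2 by lra.
    by move=> k; rewrite inE => /orP[/eqP->//|kl]; exact: h1.
  move=> kl; rewrite (kl h) ?mem_head//; congr (_ + _).
  by apply: h2 => k kk; apply: kl; rewrite inE kk orbT.
have tP y : polyhedron s y -> {in tight s x, forall h, halfspace h y}.
  by move=> Py h; rewrite mem_tight => /andP[_]; exact: Py.
exists H; split=> [y /tP|]; first exact: H1.
apply/seteqP; split=> y [Py]; first by move/tight_linP/(H2 _ (tP _ Py)).
by move/(H2 _ (tP _ Py))/tight_linP.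
Qed.

(** The segment from [y] to [x] extends a little beyond [x] inside the polyhedron. The form
    supporting [F] is maximal at [x], hence constant along it. *)
Lemma min_face_subset s x F : face (polyhedron s) F -> F x -> min_face s x `<=` F.
Proof.
move=> [_ [H [PH ->]]] [Px Hx] y [Py yx]; split=> //.
have [e e0 es] := lin_tight_eps Px yx.
have [|Pe _] := es (- e); first by rewrite normrN gtr0_norm.
have := PH _ Pe; have := PH _ Py; move: Hx.
rewrite /halfspace /hyperplane /= dotDr dotZr dotBr => Hx Hy He.
apply/eqP; rewrite eq_le Hy /= -Hx -subr_ge0 -(pmulr_rge0 _ e0).
by move: He; rewrite Hx mulNr; lra.
Qed.

Lemma polyhedron_convex s x y t : 0 <= t <= 1 ->
  polyhedron s x -> polyhedron s y -> polyhedron s (x + t *: (y - x)).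
Proof.
move=> t01 Px Py h hs; have := Px h hs; have := Py h hs.
rewrite /halfspace /= dotDr dotZr dotBr; nra.
Qed.

(* A point of F with the fewest active constraints generates F: the midpoint
   with any other point of F would have even fewer. *)
Lemma face_is_min_face s F : face (polyhedron s) F ->
  exists x, [/\ polyhedron s x, F x & F = min_face s x].
Proof.
move=> FF; have [[x0 Fx0] _] := FF.
have [k [x [Fx ks kmax]]] : exists k x, [/\ F x, \dim (lin (tight s x)) = k &
    forall y, F y -> (\dim (lin (tight s y)) <= k)%N].
  pose p k := `[< exists2 x, F x & \dim (lin (tight s x)) = k >].
  have ep : exists k, p k by exists (\dim (lin (tight s x0))); apply/asboolP; exists x0.
  have bp k : p k -> (k <= n)%N by move=> /asboolP[x _ <-]; exact: dim_lin_le.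
  exists (ex_maxn ep bp); case: ex_maxnP => k /asboolP[x Fx xk] kmax.
  by exists x; split=> // y Fy; apply: kmax; apply/asboolP; exists y.
have [_ [H [PH FE]]] := FF.
have Px : polyhedron s x by move: Fx; rewrite FE => -[].
exists x; split=> //; apply/seteqP; split; last exact: min_face_subset.
move=> y Fy; have Py : polyhedron s y by move: Fy; rewrite FE => -[].
split=> //; pose z := x + (2^-1 : R) *: (y - x).
have Pz : polyhedron s z by apply: polyhedron_convex => //; lra.
have Fz : F z.
  rewrite FE; split=> //; move: Fx Fy; rewrite FE => -[_ Hx] [_ Hy].
  by rewrite /hyperplane /= dotDr dotZr dotBr Hx Hy subrr mulr0 addr0.
have tz h : h \in tight s z -> dot h.1 x = h.2 /\ dot h.1 y = h.2.
  rewrite mem_tight => /andP[+ hs]; have := Px h hs; have := Py h hs.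
  rewrite /halfspace /= dotDr dotZr dotBr => h1 h2 /eqP h3; split; lra.
have zx : {subset tight s z <= tight s x}.
  move=> h hz; rewrite mem_tight (tz h hz).1 eqxx /=.
  by move: hz; rewrite mem_tight => /andP[].
have /eqP -> : lin (tight s x) == lin (tight s z).
  by rewrite eqEdim lin_subset// ks kmax.
by apply/linP => h /tz[hx hy]; rewrite dotBr hx hy subrr.
Qed.

(** A nonzero direction killed by the active forms would stretch the face beyond one point. *)
Lemma vertexP s v :
  vertex (polyhedron s) v <-> polyhedron s v /\ lin (tight s v) = 0%VS.
Proof.
split=> [vv|[Pv L0]]; last first.
  have := face_min_face Pv; rewrite /vertex; congr face.
  apply/seteqP; split=> y /=; last by move=> ->; exact: min_face_refl.
  by case=> _; rewrite L0 memv0 subr_eq0 => /eqP.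
have [x [Px vx vE]] := face_is_min_face vv; move: vx vE Px => /= -> vE Pv {x}.
suff Lv : (lin (tight s v) <= 0)%VS by split=> //; apply/eqP; rewrite -subv0.
apply/subvP => d dv; have [e e0 es] := lin_tight_eps Pv dv.
have [|Pe _] := es e; first by rewrite gtr0_norm.
have : min_face s v (v + e *: d) by split=> //; rewrite addrC addKr memvZ.
rewrite -vE /= => /eqP; rewrite -subr_eq0 addrC addKr scaler_eq0 (gt_eqF e0) /=.
by rewrite memv0.
Qed.

End Faces.

(** * Existence and finiteness of vertices, and edges, of bounded polyhedra *)

Section BoundedPolyhedra.
Context {R : realType} {n : nat}.
Local Notation V := 'rV[R]_n.
Implicit Types (a x y d v : V) (s : seq (V * R)) (h : V * R).

Lemma bounded_set_bound (A : set V) : bounded_set A ->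
  exists M : R, forall x, A x -> `|x| <= M.
Proof. by move=> [M [_ MA]]; exists (M + 1) => x; apply: MA; rewrite ltrDl. Qed.

(** Follow the ray until a new constraint becomes active. The old ones are constant along [d] and
    the new one is not, so the kernel shrinks strictly. *)
Lemma ray_exit s x d : bounded_set (polyhedron s) -> polyhedron s x ->
  d != 0 -> d \in lin (tight s x) ->
  exists t : R, [/\ 0 < t, polyhedron s (x + t *: d),
    {subset tight s x <= tight s (x + t *: d)} &
    (\dim (lin (tight s (x + t *: d))) < \dim (lin (tight s x)))%N].
Proof.
move=> /bounded_set_bound[M MP] Px d0 dx.
pose c := [seq h <- s | 0 < dot h.1 d].
have c0 : c != [::].
  (* If no constraint increased along [d], the whole ray would stay inside; this [t] makes the
     displacement longer than boundedness allows. *)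
  apply/eqP => c0; pose t := (M + `|x| + 1) / `|d|.
  have M0 : 0 <= M by rewrite (le_trans _ (MP _ Px)).
  have t0 : 0 <= t by rewrite divr_ge0// !addr_ge0.
  have : polyhedron s (x + t *: d).
    move=> h hs; rewrite /halfspace /= dotDr dotZr.
    have hd : dot h.1 d <= 0.
      rewrite leNgt; apply/negP => hd; have : h \in c by rewrite mem_filter hd.
      by rewrite c0.
    have := Px h hs; rewrite /halfspace /=; nra.
  move/MP => tM; have : `|t *: d| <= M + `|x|.
    have -> : t *: d = (x + t *: d) - x by rewrite addrAC subrr add0r.
    by apply: le_trans (ler_normB _ _) _; rewrite lerD.
  rewrite normrZ ger0_norm// /t divfK ?normr_eq0//; lra.
(* Among the increasing constraints, the one reached first. *)
have [h] := seq_argmin (fun h => (h.2 - dot h.1 x) / dot h.1 d) c0.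
rewrite mem_filter => /andP[hd hs]; set t := (_ / _) => tmin.
have hx : h \notin tight s x.
  by apply/negP => /(linP _ _ dx) h0; rewrite h0 ltxx in hd.
have t0 : 0 < t by rewrite divr_gt0// subr_gt0 (strict_or_tight Px).
exists t; have sub : {subset tight s x <= tight s (x + t *: d)}.
  move=> k kx; move: (kx); rewrite !mem_tight => /andP[/eqP kE ->].
  by rewrite dotDr dotZr (linP _ _ dx)// mulr0 addr0 kE eqxx.
have ht : h \in tight s (x + t *: d).
  rewrite mem_tight hs andbT dotDr dotZr /t divfK ?(gt_eqF hd)//.
  by rewrite subrKC.
split=> //.
  move=> k ks; rewrite /halfspace /= dotDr dotZr.
  have [kd|kd] := ltP 0 (dot k.1 d); last first.
    by have := Px k ks; rewrite /halfspace /=; nra.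
  rewrite -lerBrDl -ler_pdivlMr//; apply: tmin; by rewrite mem_filter kd.
rewrite ltnNge; apply/negP => le; have : lin (tight s (x + t *: d)) == lin (tight s x).
  by rewrite eqEdim lin_subset.
move/eqP => E; move: dx; rewrite -E => /linP/(_ _ ht) h0.
by rewrite h0 ltxx in hd.
Qed.

(** Walk inside the minimal face of [x] in a direction along which [a] does not increase; each exit
    lowers the dimension, so the walk ends at a vertex. With [a = 0] this just yields a vertex of
    that face. *)
Lemma vertex_below s a x : bounded_set (polyhedron s) -> polyhedron s x ->
  exists v, [/\ vertex (polyhedron s) v, {subset tight s x <= tight s v}
    & dot a v <= dot a x].
Proof.
move=> bP; have [k] := ubnP (\dim (lin (tight s x))).
elim: k x => // k IH x xk Px.
have [L0|/eqP L0] := eqVneq (lin (tight s x)) 0%VS.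
  by exists x; split=> //; apply/vertexP.
pose d0 := vpick (lin (tight s x)).
have d0x : d0 \in lin (tight s x) by exact: memv_pick.
have [d [dx dn0 ad]] : exists d, [/\ d \in lin (tight s x), d != 0 & dot a d <= 0].
  have d00 : d0 != 0 by rewrite vpick0; apply/eqP.
  have [ad|ad] := lerP (dot a d0) 0; first by exists d0.
  by exists (- d0); rewrite memvN oppr_eq0 dotNr oppr_le0 ltW.
have [t [t0 Pt sub lt]] := ray_exit bP Px dn0 dx.
have [v [vv vs av]] := IH _ (leq_trans lt xk) Pt.
exists v; split=> //; first by move=> h /sub/vs.
apply: le_trans av _; rewrite dotDr dotZr; nra.
Qed.

Lemma vertex_tight_inj s v w : vertex (polyhedron s) v ->
  {subset tight s v <= tight s w} -> w = v.
Proof.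
move=> /vertexP[_ L0] vw; apply/eqP; rewrite -subr_eq0 -memv0 -L0.
by apply/tight_linP => h /vw; rewrite mem_tight => /andP[/eqP].
Qed.

(** A vertex is determined by its set of active constraints, encoded here as a boolean function on
    positions in [s]. *)
Lemma finite_vertices s :
  exists2 vs, uniq vs & forall v, vertex (polyhedron s) v <-> v \in vs.
Proof.
pose f v : {ffun 'I_(size s) -> bool} :=
  [ffun i => dot (tnth (in_tuple s) i).1 v == (tnth (in_tuple s) i).2].
have finj : set_inj (vertex (polyhedron s)) f.
  move=> v w; rewrite !inE => vv vw fvw; apply/esym/(vertex_tight_inj vv) => h.
  rewrite !mem_tight => /andP[hv hs]; rewrite hs andbT.
  have [i hi] := seq_tnthP hs; have /ffunP/(_ i) := fvw.
  by rewrite !ffunE /= -hi hv => <-.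
have : finite_set (f @` vertex (polyhedron s)).
  exact: finite_finset.
rewrite (eq_finite_set (inj_card_eq finj)) => /finite_seqP[vs vsE].
exists (undup vs); first exact: undup_uniq.
by move=> v; rewrite vsE mem_undup.
Qed.

(** The descents start slightly to either side of [x] along [d], which makes both inequalities
    strict and the two vertices distinct. *)
Lemma two_vertices s x d : bounded_set (polyhedron s) -> polyhedron s x ->
  d != 0 -> d \in lin (tight s x) ->
  exists v w, [/\ vertex (polyhedron s) v, vertex (polyhedron s) w,
    {subset tight s x <= tight s v}, {subset tight s x <= tight s w} &
    dot d v < dot d x < dot d w].
Proof.
move=> bP Px d0 dx; have [e e0 es] := lin_tight_eps Px dx.
have dd := dot_self_gt0 d0.
have [|P1 T1] := es (- e); first by rewrite normrN gtr0_norm.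
have [|P2 T2] := es e; first by rewrite gtr0_norm.
have [v [vv vs va]] := vertex_below d bP P1.
have [w [vw ws wa]] := vertex_below (- d) bP P2.
move: va wa vs ws; rewrite T1 T2 !dotNl !dotDr !dotZr => va wa vs ws.
have ed := mulr_gt0 e0 dd.
exists v, w; split=> //.
by apply/andP; split; lra.
Qed.

(* Among faces through x of positive dimension take the smallest; were it of
   dimension > 1, its rays in a plane would exit at infinitely many vertices. *)
Lemma edge_through s x : bounded_set (polyhedron s) -> polyhedron s x ->
  lin (tight s x) <> 0%VS ->
  exists y, [/\ polyhedron s y, {subset tight s x <= tight s y}
    & \dim (lin (tight s y)) = 1%N].
Proof.
move=> bP; have [k] := ubnP (\dim (lin (tight s x))).
elim: k x => // k IH x xk Px /eqP L0; set U := lin _ in xk L0 *.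
have U0 : (0 < \dim U)%N by rewrite lt0n dimv_eq0.
have [U1|U1] := eqVneq (\dim U) 1%N; first by exists x; split.
have U2 : (1 < \dim U)%N by rewrite ltn_neqAle eq_sym U1.
pose d1 := vpick U; have d1U : d1 \in U by exact: memv_pick.
have d10 : d1 != 0 by rewrite vpick0.
have /subvPn[d2 d2U d2d1] : ~~ (U <= <[d1]>)%VS.
  apply: contraL U2 => /dimvS; rewrite -leqNgt => /leq_trans; apply.
  by rewrite dim_vline; case: eqP.
pose D (i : nat) := d1 + i%:R *: d2.
have DU i : D i \in U by rewrite memvD// memvZ.
have indep (a b : R) : a *: d1 = b *: d2 -> a = 0 /\ b = 0.
  move=> ab; have b0 : b = 0.
    apply/eqP; apply: contraNT d2d1 => b0; apply/vlineP; exists (b^-1 * a).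
    by rewrite -scalerA ab scalerA mulVf// scale1r.
  split=> //; move/eqP: ab; rewrite b0 scale0r scaler_eq0 (negPf d10) orbF.
  by move/eqP.
have D0 i : D i != 0.
  rewrite /D -[X in _ + X]opprK subr_eq0; apply/eqP => E.
  have [] := indep 1 (- i%:R); first by rewrite scale1r scaleNr.
  by move/eqP; rewrite oner_eq0.
have [t tP] := choice (fun i => ray_exit bP Px (D0 i) (DU i)).
have [[i Li]|nL] := pselect (exists i, lin (tight s (x + t i *: D i)) <> 0%VS).
  have [_ Pi si di] := tP i.
  have [y [Py sy dy]] := IH _ (leq_trans di xk) Pi Li.
  by exists y; split=> // h /si/sy.
have [vs uvs vsP] := finite_vertices s; pose y i := x + t i *: D i.
have yvs i : y i \in vs.
  apply/vsP/vertexP; have [_ Pi _ _] := tP i; split=> //.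
  by apply: contrapT => Li; apply: nL; exists i.
have yinj : injective y.
  move=> i j /addrI; rewrite /D !scalerDr !scalerA => E.
  have [] := indep (t i - t j) (t j * j%:R - t i * i%:R).
    rewrite !scalerBl; apply/eqP; rewrite subr_eq addrAC eq_sym subr_eq eq_sym.
    by rewrite E addrC.
  move/eqP; rewrite subr_eq0 => /eqP -> /eqP; rewrite -mulrBr mulf_eq0.
  have [tj _ _ _] := tP j; rewrite (gt_eqF tj) /= subr_eq0 eqr_nat => /eqP->//.
have := @uniq_leq_size _ (map y (iota 0 (size vs).+1)) vs.
rewrite map_inj_uniq// iota_uniq size_map size_iota ltnn => /(_ isT) F; suff: false by [].
by apply: F; move=> _ /mapP[i _ ->].
Qed.

End BoundedPolyhedra.

(** * Irredundant systems of inequalities and facets *)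

Section Irredundant.
Context {R : realType} {n : nat}.
Local Notation V := 'rV[R]_n.
Implicit Types (a x y d v q : V) (s : seq (V * R)) (h k : V * R) (F P : set V).

(** Irredundancy is expressed by witnesses: [c] is an interior point and each [q] a relatively
    interior point of the facet of [h]. Such points yield the facets and their distinctness
    directly, and can be exhibited when cuts are added. *)
Definition irredundant s :=
  [/\ uniq s, exists c, {in s, forall h, dot h.1 c < h.2} &
    forall h, h \in s -> h.1 != 0 /\
      exists2 q, dot h.1 q = h.2 &
        {in s, forall k, k != h -> dot k.1 q < k.2}].

Lemma irredundant_witness s h : irredundant s -> h \in s ->
  exists2 q, polyhedron s q & tight s q =i [:: h].
Proof.
move=> [_ _ irr] hs; have [_ [q hq sq]] := irr h hs; exists q.
  move=> k ks; rewrite /halfspace /=.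
  by have [->|kh] := eqVneq k h; [rewrite hq|rewrite ltW// sq].
move=> k; rewrite mem_tight inE; have [->|kh] := eqVneq k h; first by rewrite hq hs eqxx.
by apply/andP => -[/eqP kq ks]; have := sq _ ks kh; rewrite kq ltxx.
Qed.

(** A facet is the minimal face of a point whose active forms have an (n-1)-dimensional kernel,
    which is already the kernel of any one of them. Conversely, [h] is the only active constraint at
    its witness. *)
Lemma facet_polyhedronP s F : irredundant s -> (0 < n)%N ->
  facet (polyhedron s) F <->
  exists2 h, h \in s & F = polyhedron s `&` hyperplane h.
Proof.
move=> irs n0; split=> [[/face_is_min_face[x [Px Fx FE]] Fd]|[h hs ->]]; last first.
  have [q Pq tq] := irredundant_witness irs hs.
  have [_ _ /(_ h hs)[h0 _]] := irs.
  have -> : polyhedron s `&` hyperplane h = min_face s q.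
    apply/seteqP; split=> y [Py hy]; split=> //.
      by apply/tight_linP => k; rewrite tq inE => /eqP->.
    by apply: (tight_linP _ _ _ hy); rewrite tq mem_head.
  split; first exact: face_min_face.
  by rewrite -(dim_lin1 h0) -(lin_eq_mem tq); exact: has_dim_min_face.
have dx : \dim (lin (tight s x)) = n.-1.
  by apply: (has_dim_uniq _ Fd); rewrite FE; exact: has_dim_min_face.
have [h hx] : exists h, h \in tight s x.
  case: (tight s x) dx => [|h l _]; last by exists h; rewrite mem_head.
  rewrite dim_lin_nil; lia.
have hs : h \in s by move: hx; rewrite mem_tight => /andP[].
have [_ _ /(_ h hs)[h0 _]] := irs.
have lE : lin (tight s x) = lin [:: h].
  apply/eqP; rewrite eqEdim dx dim_lin1// leqnn andbT lin_subset//.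
  by move=> k; rewrite inE => /eqP->.
exists h => //; rewrite FE; apply/seteqP; split=> y [Py].
  by move=> /tight_linP/(_ _ hx).
rewrite /hyperplane /= => hy; split=> //; rewrite lE; apply/linP => k.
rewrite inE => /eqP->; rewrite dotBr hy; move: hx; rewrite mem_tight => /andP[/eqP-> _].
by rewrite subrr.
Qed.

Lemma facet_inj s : irredundant s ->
  {in s &, injective (fun h => polyhedron s `&` hyperplane h)}.
Proof.
move=> irs h k hs ks hk; have [q Pq tq] := irredundant_witness irs hs.
have : (polyhedron s `&` hyperplane h) q.
  split=> //; have : h \in tight s q by rewrite tq mem_head.
  by rewrite mem_tight => /andP[/eqP].
rewrite hk => -[_ /= qk]; have : k \in tight s q by rewrite mem_tight qk eqxx.
by rewrite tq inE => /eqP.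
Qed.

Lemma facets_at s x : irredundant s -> (0 < n)%N -> polyhedron s x ->
  [set F | facet (polyhedron s) F /\ F x] =
  (fun h => polyhedron s `&` hyperplane h) @` [set` tight s x].
Proof.
move=> irs n0 Px; apply/seteqP; split=> F /=.
  move=> [/(facet_polyhedronP _ irs n0)[h hs ->] [_ xh]].
  by exists h => //=; rewrite mem_tight hs andbT; apply/eqP.
move=> [h /=]; rewrite mem_tight => /andP[/eqP xh hs] <-; split=> //.
by apply/(facet_polyhedronP _ irs n0); exists h.
Qed.

Lemma card_facets_at s x : irredundant s -> (0 < n)%N -> polyhedron s x ->
  [set F | facet (polyhedron s) F /\ F x] #= `I_(size (tight s x)).
Proof.
move=> irs n0 Px; rewrite facets_at//; apply: card_seq.
  by case: irs => us _ _; rewrite filter_uniq.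
by move=> h k; rewrite !mem_tight => /andP[_ hs] /andP[_ ks]; exact: facet_inj.
Qed.

Lemma facets_above s x : irredundant s -> (0 < n)%N -> polyhedron s x ->
  [set F | facet (polyhedron s) F /\ min_face s x `<=` F] =
  [set F | facet (polyhedron s) F /\ F x].
Proof.
move=> irs n0 Px; apply/seteqP; split=> F [fF xF]; split=> //.
  by apply: xF; exact: min_face_refl.
by apply: min_face_subset => //; case: fF.
Qed.

Lemma has_dim_interior s c : {in s, forall h, dot h.1 c < h.2} ->
  has_dim (polyhedron s) n.
Proof.
move=> sc; have Pc : polyhedron s c by move=> h hs; apply: ltW; exact: sc.
have tc : tight s c = [::].
  rewrite /tight -(filter_pred0 s); apply: eq_in_filter => h hs /=.
  by rewrite lt_eqF// sc.
have := has_dim_min_face Pc; rewrite tc dim_lin_nil; congr has_dim.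
apply/seteqP; split=> y; first by case.
by move=> Py; split=> //; rewrite tc /lin big_nil memvf.
Qed.

(** The polyhedron is a face of itself, hence the minimal face of some point; full dimension forces
    every form active at that point to be zero. *)
Lemma interior_point s : (0 < n)%N -> has_dim (polyhedron s) n ->
  exists c, polyhedron s c /\
    {in s, forall h, h.1 != 0 -> dot h.1 c < h.2}.
Proof.
move=> n0 Pn; have [P0|/eqP] := eqVneq (polyhedron s) set0.
  (* An empty set has no point in its affine hull: a base point shifted from [x0] with zero
     direction space excludes [x0]. The shift is nonzero because [n > 0]. *)
  have [x0 [U [E _]]] := Pn; have : affine_hull (polyhedron s) x0.
    by rewrite E /= subrr mem0v.
  rewrite P0 => /(_ (x0 + const_mx 1) 0%VS) /=.
  rewrite opprD addrA subrr sub0r memvN memv0 => E'.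
  have /eqP/rowP/(_ (Ordinal n0)) := E' (fun y (F : False) => False_ind _ F).
  by rewrite !mxE => /eqP; rewrite oner_eq0.
move/eqP/set0P => P0; have : face (polyhedron s) (polyhedron s).
  split=> //; exists (0, 0); rewrite /halfspace /hyperplane /=; split=> [y _ /=|].
    by rewrite dot0l.
  by apply/seteqP; split=> [y Py|y []//]; split=> //=; rewrite dot0l.
move=> /face_is_min_face[x [Px _ Px']]; exists x; split=> // h hs h0.
have dx : \dim (lin (tight s x)) = n.
  by apply: (has_dim_uniq _ Pn); rewrite Px'; exact: has_dim_min_face.
apply: (strict_or_tight Px hs); apply: contra h0 => hx.
by apply/eqP/(lin_full _ hx); rewrite dx.
Qed.

Lemma irredundant_sub s c : uniq s -> {in s, forall h, h.1 != 0} ->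
  {in s, forall h, dot h.1 c < h.2} ->
  exists2 s', irredundant s' & polyhedron s' = polyhedron s.
Proof.
have [m] := ubnP (size s); elim: m s => // m IH s sm us s0 sc.
have [W|/existsNP[h /not_implyP[hs nW]]] := pselect (forall h, h \in s ->
    exists2 q, dot h.1 q = h.2 & {in s, forall k, k != h -> dot k.1 q < k.2}).
  by exists s => //; split=> //; [exists c|move=> h hs; split; [exact: s0|exact: W]].
have sub k : k \in rem h s -> k \in s by exact: mem_rem.
have [||||s' irs' Ps'] := IH (rem h s).
- by rewrite size_rem//; move: sm; case: (s) hs.
- exact: rem_uniq.
- by move=> k /sub; exact: s0.
- by move=> k /sub; exact: sc.
exists s' => //; rewrite Ps'; apply/seteqP; split=> z Pz; last by move=> k /sub/Pz.
move=> k ks; have [->{k ks}|kh] := eqVneq k h; last by apply: Pz; rewrite rem_filter// mem_filter /= kh.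
rewrite /halfspace /= leNgt; apply/negP => hz; apply: nW.
have hc := sc h hs; pose t := (h.2 - dot h.1 c) / (dot h.1 z - dot h.1 c).
have zc0 : 0 < dot h.1 z - dot h.1 c by lra.
have t0 : 0 < t by rewrite divr_gt0// subr_gt0.
have t1 : t < 1 by rewrite ltr_pdivrMr// mul1r; lra.
exists (c + t *: (z - c)).
  by rewrite dotDr dotZr dotBr divfK ?(gt_eqF zc0)// addrC subrK.
move=> k ks kh; have kc := sc k ks.
have : halfspace k z by apply: Pz; rewrite rem_filter// mem_filter /= kh.
rewrite /halfspace /= dotDr dotZr dotBr; nra.
Qed.

Lemma polytope_irredundant P : (0 < n)%N -> polytope P -> has_dim P n ->
  exists2 s, irredundant s & P = polyhedron s.
Proof.
move=> n0 [_ [s ->]] Pn; have [c [Pc sc]] := interior_point n0 Pn.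
(* A constraint with zero form holds everywhere, because it holds at [c]. *)
pose s1 := undup [seq h <- s | h.1 != 0].
have [|||s' irs' Ps'] := @irredundant_sub s1 c.
- exact: undup_uniq.
- by move=> h; rewrite mem_undup mem_filter => /andP[].
- by move=> h; rewrite mem_undup mem_filter => /andP[h0 hs]; exact: sc.
exists s' => //; rewrite Ps'; apply/seteqP; split=> y Py h.
  by rewrite mem_undup mem_filter => /andP[_]; exact: Py.
have [h0|h0] := eqVneq h.1 0; last by move=> hs; apply: Py; rewrite mem_undup mem_filter h0.
by move=> hs; have := Pc h hs; rewrite /halfspace /= h0 !dot0l.
Qed.

End Irredundant.

(** * Counting active constraints on an edge-simple polytope *)

Section EdgeSimple.
Context {R : realType} {n : nat}.
Local Notation V := 'rV[R]_n.
Variable s : seq (V * R).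
Hypotheses (irs : irredundant s) (n_gt1 : (1 < n)%N)
  (esP : edge_simple (polyhedron s)).
Implicit Types (x y : V).

Let n_gt0 : (0 < n)%N := ltnW n_gt1.
Let bP : bounded_set (polyhedron s). Proof. by case: esP => -[]. Qed.

Lemma edge_min_face x : polyhedron s x -> \dim (lin (tight s x)) = 1%N ->
  edge (polyhedron s) (min_face s x).
Proof.
by move=> Px dx; split; [exact: face_min_face|rewrite -dx; exact: has_dim_min_face].
Qed.

Lemma size_tight_edge x : polyhedron s x -> \dim (lin (tight s x)) = 1%N ->
  size (tight s x) = n.-1.
Proof.
move=> Px dx; have [_ _ /(_ _ (edge_min_face Px dx))[cE _]] := esP.
rewrite facets_above// in cE; apply/card_eq_II.
apply: card_eq_trans cE; rewrite card_eq_sym; exact: card_facets_at.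
Qed.

(* The active forms at x are part of the n - 1 active forms on an edge, and
   those are independent because their common kernel is a line. *)
Lemma dim_lin_tight x : polyhedron s x -> lin (tight s x) <> 0%VS ->
  (\dim (lin (tight s x)) + size (tight s x))%N = n.
Proof.
move=> Px Lx; have [y [Py xy dy]] := edge_through bP Px Lx.
have sy := size_tight_edge Py dy.
have us : uniq s by case: irs.
pose r := [seq h <- tight s y | h \notin tight s x].
have yE : perm_eq (tight s y) (tight s x ++ r).
  rewrite uniq_perm ?cat_uniq ?filter_uniq//=.
    by rewrite andbT; apply/hasPn => h; rewrite mem_filter => /andP[].
  move=> h; rewrite mem_cat [h \in r]mem_filter.
  by have [/xy->//|] := boolP (h \in tight s x).
have := dim_lin_cat (tight s x) r; rewrite -(lin_eq_mem (perm_mem yE)) dy.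
have := perm_size yE; rewrite size_cat sy.
have := dim_lin_ge (tight s x); move: n_gt1.
by move: (\dim _) (size _) (size _) => a b c; lia.
Qed.

Lemma min_face_bigcap x (I : Type) (h : I -> V * R) : polyhedron s x ->
  (forall k, k \in tight s x <-> exists i, h i = k) ->
  min_face s x =
  polyhedron s `&` \bigcap_i (polyhedron s `&` hyperplane (h i)).
Proof.
move=> Px hx; apply/seteqP; split=> y [Py].
  move=> /tight_linP xy; split=> // i _; split=> //.
  by apply: xy; apply/hx; exists i.
move=> yh; split=> //; apply/tight_linP => k /hx[i <-].
by have [] := yh i Logic.I.
Qed.

End EdgeSimple.

(** * Cutting off the vertices *)

Section Cuts.
Context {R : realType} {n : nat}.
Local Notation V := 'rV[R]_n.
Implicit Types (a x y u v w : V) (t : R).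

Lemma convex_lt (b t p q : R) : 0 <= t <= 1 -> p < b -> q < b ->
  p + t * (q - p) < b.
Proof.
move=> /andP[t0 t1] pb qb; have [->|tn1] := eqVneq t 1; first by lra.
have : t < 1 by rewrite lt_neqAle tn1.
nra.
Qed.

Lemma segment_crossing a (b : R) x y : dot a x < dot a y -> dot a x <= b <= dot a y ->
  exists t, 0 <= t <= 1 /\ dot a (x + t *: (y - x)) = b.
Proof.
move=> xy /andP[xb yb]; exists ((b - dot a x) / (dot a y - dot a x)).
have p : 0 < dot a y - dot a x by rewrite subr_gt0.
split; last by rewrite dotDr dotZr dotBr divfK ?(gt_eqF p)// addrC subrK.
rewrite divr_ge0 ?subr_ge0//=; last exact: ltW.
by rewrite ler_pdivrMr// mul1r lerD2r.
Qed.

Variables (s : seq (V * R)) (H : V -> V * R).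
Local Notation P := (polyhedron s).
Hypotheses (irs : irredundant s) (n_gt1 : (1 < n)%N) (bP : bounded_set P)
  (HP : vertex_cut P H).

Let vertex_in v : vertex P v -> P v. Proof. by move=> /vertexP[]. Qed.

(* On a segment, two disjoint cuts may swallow everything, as when each of them
   lies beyond the other; a third vertex is what excludes this below. *)
Lemma exists_third_vertex v w : exists u, [/\ vertex P u, u <> v & u <> w].
Proof.
(* A nonzero form [a] with equal values at [v] and [w] exists in dimension at least 2. Since [P] has
   interior points, [a] takes another value on [P], hence at a vertex different from both. *)
pose l := [:: (w - v, 0 : R)].
have dl : (0 < \dim (lin l))%N.
  by have := dim_lin_ge l; rewrite /= addn1 => le; rewrite -ltnS (leq_trans n_gt1).
pose a := vpick (lin l).
have a0 : a != 0 by rewrite vpick0 -dimv_eq0 -lt0n.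
have /linP/(_ _ (mem_head _ _))/= : a \in lin l by exact: memv_pick.
rewrite dotC dotBr => /eqP; rewrite subr_eq0 => /eqP avw.
have [x Px ax] : exists2 x, P x & dot a x != dot a v.
  have [_ [c sc] _] := irs.
  have [e e0 es] := strict_eps a sc.
  have [ac|ac] := eqVneq (dot a c) (dot a v); last first.
    by exists c => // h hs; apply: ltW; exact: sc.
  exists (c + e *: a).
    by move=> h hs; apply/ltW/es => //; rewrite gtr0_norm.
  rewrite dotDr dotZr ac -subr_eq0 addrAC subrr add0r mulf_neq0//.
    by rewrite gt_eqF.
  by rewrite gt_eqF// dot_self_gt0.
have [ax'|ax'] := ltP (dot a x) (dot a v).
  have [u [uv _ ux]] := vertex_below a bP Px.
  by exists u; split=> // E; move: ux; rewrite E ?avw; lra.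
have [u [uv _ ux]] := vertex_below (- a) bP Px.
have ax2 : dot a v < dot a x by rewrite lt_neqAle eq_sym ax.
by exists u; split=> // E; move: ux; rewrite E !dotNl ?avw; lra.
Qed.

(** Upgrades disjointness of the two hyperplanes inside [P] to disjointness of the caps that they
    cut off. *)
Lemma cut_disjoint v w x : vertex P v -> vertex P w -> v <> w -> P x ->
  (H v).2 <= dot (H v).1 x -> dot (H w).1 x < (H w).2.
Proof.
move=> vv vw vw' Px xv; rewrite ltNge; apply/negP => xw.
have [HPv HPd] := HP.
have [_ vHv Hv] := HPv v vv; have [_ wHw Hw] := HPv w vw.
have wv : dot (H v).1 w < (H v).2 by apply: Hv => // E; exact: vw'.
(* First the section by the cut at [v]. Both [v] and a third vertex [u] are inside the cut at [w],
   hence so is the point [p0] where their segment meets the section. If [p] were not inside, the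
   segment from [p0] to [p] would meet both hyperplanes in [P]. *)
have Hw_on_v p : P p -> dot (H v).1 p = (H v).2 -> dot (H w).1 p < (H w).2.
  move=> Pp pv; rewrite ltNge; apply/negP => pw.
  have [u [vu uv uw]] := exists_third_vertex v w.
  have uHv := Hv _ vu uv; have uHw := Hw _ vu uw; have vHw := Hw _ vv vw'.
  have [||t [t01 tE]] := @segment_crossing (H v).1 (H v).2 u v; first lra.
    by apply/andP; split; lra.
  set p0 := u + _ in tE.
  have Pp0 : P p0 by apply: polyhedron_convex => //; exact: vertex_in.
  have p0w : dot (H w).1 p0 < (H w).2.
    by rewrite /p0 dotDr dotZr dotBr; exact: convex_lt.
  have [||r [r01 rE]] := @segment_crossing (H w).1 (H w).2 p0 p; first lra.
    by apply/andP; split; lra.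
  have := HPd v w vv vw vw'; apply/eqP/set0P; exists (p0 + r *: (p - p0)).
  split; last exact: polyhedron_convex.
  by split=> //; rewrite /hyperplane /= dotDr dotZr dotBr tE pv subrr mulr0 addr0.
(* Both [w] and [x] are on or beyond the cut at [w], hence so is the point where their segment
   crosses the cut at [v], against the previous step. *)
have [||t [t01 tE]] := @segment_crossing (H v).1 (H v).2 w x; first lra.
  by apply/andP; split; lra.
have := Hw_on_v _ (polyhedron_convex t01 (vertex_in vw) Px) tE.
by rewrite dotDr dotZr dotBr; nra.
Qed.

(** Where the segment crosses the cut at [v], all other cuts are strict by [cut_disjoint]; a small
    move toward [w] makes the cut at [v] strict too. Thus a face of [P] with two vertices has a
    point away from all cuts. *)
Lemma segment_avoids_cuts v w : vertex P v -> vertex P w -> v <> w ->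
  exists x, [/\ P x, forall u, vertex P u -> dot (H u).1 x < (H u).2 &
    {in tight s v, forall h, h \in tight s w -> dot h.1 x = h.2}].
Proof.
move=> vv vw vw'; have [HPv HPd] := HP.
have [_ vHv Hv] := HPv v vv.
have wHv : dot (H v).1 w < (H v).2 by apply: Hv => // E; exact: vw'.
have [||t [t01 tE]] := @segment_crossing (H v).1 (H v).2 w v; first lra.
  by apply/andP; split; lra.
set p := w + _ in tE.
have Pp : P p by apply: polyhedron_convex => //; exact: vertex_in.
have pu u : vertex P u -> u <> v -> dot (H u).1 p < (H u).2.
  by move=> vu uv; apply: (cut_disjoint vv vu) => //; [move/esym|rewrite tE].
have [vs _ vsP] := finite_vertices s.
have [|e e0 es] := @strict_eps _ _ [seq H u | u <- vs & u != v] p (w - p).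
  move=> h /mapP[u]; rewrite mem_filter => /andP[/eqP uv /vsP vu] ->.
  exact: pu.
have e01 : 0 < Num.min e 1 <= 1 by rewrite lt_min e0 ltr01 ge_min lexx orbT.
have ee : `|Num.min e 1| <= e by rewrite gtr0_norm ?ge_min ?lexx//; case/andP: e01.
move: (Num.min e 1) e01 ee => r r01 re.
exists (p + r *: (w - p)); split.
- by apply: polyhedron_convex => //; [case/andP: r01 => /ltW -> //|exact: vertex_in].
- move=> u vu; have [->|uv] := eqVneq u v.
    by rewrite dotDr dotZr dotBr tE; nra.
  by apply: (es r re); apply/mapP; exists u; rewrite ?mem_filter ?uv //=; apply/vsP.
move=> h; rewrite !mem_tight => /andP[/eqP hv _] /andP[/eqP hw _].
by rewrite /p !(dotDr, dotZr, dotNr) hv hw; ring.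
Qed.

Variable vs : seq V.
Hypotheses (uvs : uniq vs) (vsP : forall v, vertex P v <-> v \in vs).

Definition cut_forms := s ++ map H vs.
Local Notation Q := (polyhedron cut_forms).

Lemma cut_polytopeE : cut_polytope P H = Q.
Proof.
apply/seteqP; split=> x.
  move=> [Px xH] h; rewrite mem_cat => /orP[/Px//|/mapP[v /vsP vv ->]].
  exact: xH.
move=> Qx; split=> [h hs|v /vsP vv]; apply: Qx; rewrite mem_cat ?hs//.
by rewrite map_f ?orbT.
Qed.

Lemma cut_subset x : Q x -> P x.
Proof. by rewrite -cut_polytopeE => -[]. Qed.

Lemma toward_avoids_cuts x y : (forall u, vertex P u -> dot (H u).1 x < (H u).2) ->
  exists t, 0 < t <= 1 /\
    forall u, vertex P u -> dot (H u).1 (x + t *: (y - x)) < (H u).2.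
Proof.
move=> xu; have [|e e0 es] := @strict_eps _ _ (map H vs) x (y - x).
  by move=> h /mapP[u /vsP vu ->]; exact: xu.
exists (Num.min e 1); split; first by rewrite lt_min e0 ltr01 ge_min lexx orbT.
move=> u /vsP vu; apply: es; last exact: map_f.
by rewrite gtr0_norm ?ge_min ?lexx// lt_min e0 ltr01.
Qed.

(** Push [v] and another vertex toward [c], little enough to keep them on opposite sides of the cut.
    The segment between the new points is interior to [P] and crosses the cut. *)
Lemma cut_interior_point v : vertex P v -> exists x,
  {in s, forall h, dot h.1 x < h.2} /\ dot (H v).1 x = (H v).2.
Proof.
move=> vv; have [_ [c sc] _] := irs.
have [HPv _] := HP; have [_ vHv Hv] := HPv v vv.
have [w [vw wv _]] := exists_third_vertex v v.
have wHv := Hv w vw wv.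
have near_s z t : P z -> 0 < t <= 1 -> {in s, forall h, dot h.1 (z + t *: (c - z)) < h.2}.
  move=> Pz t01 h hs; have := sc h hs; have := Pz h hs.
  by rewrite /halfspace /= dotDr dotZr dotBr; nra.
have near_v z : exists t, [/\ 0 < t <= 1 ,
    dot (H v).1 z < (H v).2 -> dot (H v).1 (z + t *: (c - z)) < (H v).2 &
    (H v).2 < dot (H v).1 z -> (H v).2 < dot (H v).1 (z + t *: (c - z))].
  (* The strict inequality satisfied by [z] relative to the cut, whichever side it is on; no
     condition if [z] lies on the cut. *)
  pose l := if dot (H v).1 z < (H v).2 then [:: H v] else
            if (H v).2 < dot (H v).1 z then [:: (- (H v).1, - (H v).2)] else [::].
  have [|e e0 es] := @strict_eps _ _ l z (c - z).
    move=> h; rewrite /l; case: ifPn => [zv|_]; first by rewrite inE => /eqP->.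
    by case: ifPn => // zv; rewrite inE => /eqP->; rewrite dotNl ltrN2.
  exists (Num.min e 1); have m01 : 0 < Num.min e 1 <= 1.
    by rewrite lt_min e0 ltr01 ge_min lexx orbT.
  have ee : `|Num.min e 1| <= e by rewrite gtr0_norm ?ge_min ?lexx//; case/andP: m01.
  split=> // zv; have := es _ ee; rewrite /l.
    by rewrite zv => /(_ _ (mem_head _ _)).
  by rewrite ltNge (ltW zv) /= zv => /(_ _ (mem_head _ _)); rewrite dotNl ltrN2.
have [t [t01 _ /(_ vHv) hv]] := near_v v.
have [r [r01 /(_ wHv) hw _]] := near_v w.
have sv := near_s _ _ (vertex_in vv) t01; have sw := near_s _ _ (vertex_in vw) r01.
move: (v + _) (w + _) hv hw sv sw => y z hy hz sy sz.
have [||q [q01 qE]] := @segment_crossing (H v).1 (H v).2 z y; first lra.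
  by apply/andP; split; lra.
exists (z + q *: (y - z)); split=> // h hs; by rewrite dotDr dotZr dotBr convex_lt// ?sy ?sz.
Qed.

Lemma cut_irredundant : irredundant cut_forms.
Proof.
have [us [c sc] irr] := irs; have [HPv HPd] := HP.
(* A small step from [x] toward [y] keeps the cuts strict and makes strict every constraint that is
   strict at [y]. *)
have push x : P x -> (forall u, vertex P u -> dot (H u).1 x < (H u).2) ->
    forall y, P y -> exists z, [/\ P z,
      (forall u, vertex P u -> dot (H u).1 z < (H u).2),
      {in s, forall h, dot h.1 y < h.2 -> dot h.1 z < h.2} &
      {in s, forall h, dot h.1 y = h.2 -> dot h.1 x = h.2 -> dot h.1 z = h.2}].
  move=> Px xu y Py; have [t [t01 zu]] := toward_avoids_cuts y xu.
  exists (x + t *: (y - x)); split=> //.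
  - by apply: polyhedron_convex => //; case/andP: t01 => /ltW ->.
  - move=> h hs hy; have := Px h hs; rewrite /halfspace /= dotDr dotZr dotBr; nra.
  - by move=> h hs hy hx; rewrite dotDr dotZr dotBr hx hy subrr mulr0 addr0.
split.
- rewrite cat_uniq us /=; apply/andP; split.
    apply/hasPn => _ /mapP[v /vsP vv ->]; apply/negP => hs.
    have := vertex_in vv hs; rewrite /halfspace /=.
    by have [_ vHv _] := HPv v vv; lra.
  rewrite map_inj_in_uniq// => v w /vsP vv /vsP vw E; apply: contrapT => vw'.
  have [_ vHv _] := HPv v vv; have [_ _ /(_ v vv vw')] := HPv w vw.
  by rewrite -E; lra.
(* The arguments [0 0] are dummies: the call produces some vertex. *)
- have [v [vv _ _]] := exists_third_vertex 0 0.
  have [w [vw wv _]] := exists_third_vertex v v.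
  have [x [Px xu _]] := segment_avoids_cuts vw vv wv.
  have [|z [Pz zu zs _]] := push x Px xu c; first by move=> h hs; apply: ltW; exact: sc.
  exists z => h; rewrite mem_cat => /orP[hs|/mapP[u /vsP vu ->]]; last exact: zu.
  by apply: zs => //; exact: sc.
move=> h; rewrite mem_cat => /orP[hs|/mapP[v /vsP vv ->]].
  have [h0 _] := irr h hs; split=> //.
  have [q Pq tq] := irredundant_witness irs hs.
  (* A facet has positive dimension, hence two distinct vertices; their segment contains a point [x]
     off all cuts and on the hyperplane of [h]. Pushing [x] toward [q] makes the other constraints
     strict. *)
  have dq : (0 < \dim (lin (tight s q)))%N.
    by rewrite (lin_eq_mem tq) dim_lin1// -ltnS prednK// ltnW.
  pose d := vpick (lin (tight s q)).
  have [||v [w [vv vw sv sw vqw]]] := @two_vertices _ _ s q d bP Pq.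
  - by rewrite vpick0 -dimv_eq0 -lt0n.
  - exact: memv_pick.
  have [|x [Px xu xt]] := segment_avoids_cuts vv vw.
    by move=> E; move: vqw; rewrite E; lra.
  have hq : h \in tight s q by rewrite tq mem_head.
  have hx := xt h (sv _ hq) (sw _ hq).
  have [z [Pz zu zs zt]] := push x Px xu q Pq.
  have hq' : dot h.1 q = h.2 by move: hq; rewrite mem_tight => /andP[/eqP].
  exists z; first exact: zt.
  move=> k; rewrite mem_cat => /orP[ks|/mapP[u /vsP vu ->] _]; last exact: zu.
  move=> kh; apply: zs => //; apply: (strict_or_tight Pq ks).
  by rewrite tq inE.
have [v0 _ _] := HPv v vv; split=> //.
have [x [xs xv]] := cut_interior_point vv; exists x => //.
have Px : P x by move=> k ks; apply: ltW; exact: xs.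
move=> k; rewrite mem_cat => /orP[/xs//|/mapP[u /vsP vu ->] uv].
apply: (cut_disjoint vv vu _ Px); last by rewrite xv.
by move=> E; rewrite E eqxx in uv.
Qed.

(** By [cut_disjoint] the section of [P] lies strictly inside all other cuts. *)
Lemma cut_hyperplane v : vertex P v ->
  P `&` hyperplane (H v) = Q `&` hyperplane (H v).
Proof.
move=> vv; apply/seteqP; split=> x [Px xv]; split=> //; last exact: cut_subset.
move=> k; rewrite mem_cat => /orP[/Px//|/mapP[u /vsP vu ->]].
have [<-|/eqP uv] := eqVneq v u; first by rewrite /halfspace /= xv.
by apply/ltW/(cut_disjoint vv vu uv Px); rewrite xv.
Qed.

Lemma tight_cut x :
  tight cut_forms x = tight s x ++ tight (map H vs) x.
Proof. exact: filter_cat. Qed.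

Lemma tight_cuts_size x : Q x -> (size (tight (map H vs) x) <= 1)%N.
Proof.
move=> Qx; have [uQ _ _] := cut_irredundant.
have : uniq (tight (map H vs) x).
  by apply: filter_uniq; move: uQ; rewrite cat_uniq => /and3P[].
case E : (tight _ _) => [|h [|k l]]//= /andP[+ _]; rewrite inE negb_or => /andP[hk _].
have : h \in tight (map H vs) x by rewrite E mem_head.
have : k \in tight (map H vs) x by rewrite E !inE eqxx orbT.
rewrite !mem_tight => /andP[/eqP kx /mapP[w /vsP vw kE]].
move=> /andP[/eqP hx /mapP[v /vsP vv hE]].
have vw' : v <> w by move=> vw'; rewrite hE kE vw' eqxx in hk.
have := cut_disjoint vv vw vw' (cut_subset Qx).
by rewrite -kE -hE hx kx lexx ltxx => /(_ isT).
Qed.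

Lemma cut_not_vertex x : Q x -> lin (tight s x) <> 0%VS.
Proof.
move=> Qx L0; have Px := cut_subset Qx.
have vx : vertex P x by apply/vertexP.
have [HPv _] := HP; have [_ + _] := HPv x vx.
have : halfspace (H x) x.
  by apply: Qx; rewrite mem_cat map_f ?orbT//; apply/vsP.
by rewrite /halfspace /=; lra.
Qed.

(** The kernel of the forms of [P] active at [x] is nonzero because [x] is not a vertex of [P], and
    at most a line because at most one active cut reduces it to zero. *)
Lemma cut_vertex x : vertex Q x ->
  \dim (lin (tight s x)) = 1%N /\
  exists2 v, vertex P v & tight cut_forms x = rcons (tight s x) (H v).
Proof.
move=> /vertexP[Qx L0].
have := dim_lin_cat (tight s x) (tight (map H vs) x).
rewrite -tight_cut L0 dimv0 add0n.
have := tight_cuts_size Qx; rewrite tight_cut.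
have : (0 < \dim (lin (tight s x)))%N.
  by rewrite lt0n dimv_eq0; apply/eqP; exact: cut_not_vertex.
case E : (tight (map H vs) x) => [|h [|//]] /= dx _; first by lia.
move=> dx'; split; first by apply/eqP; rewrite eqn_leq dx dx'.
have : h \in tight (map H vs) x by rewrite E mem_head.
rewrite mem_tight => /andP[_ /mapP[v /vsP vv ->]].
by exists v => //; rewrite cats1.
Qed.

End Cuts.

(** * Bases and direct summands of integer lattices *)

Section LatticeBases.
Context {m : nat}.
Local Notation Z := 'rV[int]_m.

(** Expressing the unit vectors in the [b i] gives a left inverse of a square matrix, which suffices
    over a commutative ring. *)
Lemma spanning_unitmx (b : 'I_m -> Z) :
  (forall x, exists c : 'rV[int]_m, x = \sum_(i < m) c 0 i *: b i) ->
  \matrix_i b i \in unitmx.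
Proof.
move=> span; have [D DE] := choice (fun i : 'I_m => span (delta_mx 0 i)).
have : (\matrix_i D i) *m (\matrix_i b i) = 1%:M.
  apply/row_matrixP => i; rewrite row_mul rowK mulmx_sum_row row1 [RHS]DE.
  by apply: eq_bigr => j _; rewrite rowK.
by move/mulmx1_unit => [].
Qed.

(* In the coordinates given by a basis, the span of a subfamily and that of the
   complementary subfamily are both cut out by vanishing of coordinates. *)
Lemma unitmx_direct_summand (b : 'I_m -> Z) (l : nat) (f : 'I_l -> 'I_m) :
  injective f -> \matrix_i b i \in unitmx ->
  direct_summand (zspan (range (b \o f))) l.
Proof.
move=> finj; set B := \matrix_i b i => uB.
pose co (x : Z) j := (x *m invmx B) 0 j.
have coD x y j : co (x + y) j = co x j + co y j by rewrite /co mulmxDl mxE.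
have coZ a x j : co (a *: x) j = a * co x j by rewrite /co -scalemxAl mxE.
have co0 j : co 0 j = 0 by rewrite /co mul0mx mxE.
have coB x y j : co (x - y) j = co x j - co y j by rewrite /co mulmxBl !mxE.
have cob i j : co (b i) j = (i == j)%:R.
  by rewrite /co -(rowK b i) -row_mul mulmxV// !mxE.
have co_sum k (F : 'I_k -> Z) j : co (\sum_(i < k) F i) j = \sum_(i < k) co (F i) j.
  by elim/big_rec2: _ => [|i y x _ <-]; rewrite ?co0 ?coD.
have coE x : x = \sum_j co x j *: b j.
  rewrite -[LHS](mulmxKV uB) mulmx_sum_row; apply: eq_bigr => j _.
  by rewrite rowK.
have co_comb (c : 'rV[int]_l) i : co (\sum_(i < l) c 0 i *: b (f i)) (f i) = c 0 i.
  rewrite co_sum (bigD1 i)//= coZ cob eqxx mulr1 big1 ?addr0// => k ki.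
  by rewrite coZ cob (inj_eq finj) (negPf ki) mulr0.
have co_comb0 (c : 'rV[int]_l) j : (forall i, f i != j) ->
    co (\sum_(i < l) c 0 i *: b (f i)) j = 0.
  by move=> fj; rewrite co_sum big1// => k _; rewrite coZ cob (negPf (fj k)) mulr0.
pose S := [set x : Z | forall j, (forall i, f i != j) -> co x j = 0].
have SE x : S x -> x = \sum_(i < l) (\row_i co x (f i)) 0 i *: b (f i).
  move=> Sx; rewrite [LHS]coE (bigID [in [seq f i | i : 'I_l]])/= addrC big1 ?add0r.
    rewrite -big_filter (perm_big [seq f i | i : 'I_l]).
      by rewrite big_image/=; apply: eq_bigr => i _; rewrite mxE.
    apply: uniq_perm; first by rewrite filter_uniq ?index_enum_uniq.
      by rewrite map_inj_uniq ?enum_uniq.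
    by move=> j; rewrite mem_filter mem_index_enum andbT.
  move=> j jf; rewrite Sx ?scale0r// => i; apply: contraNneq jf => <-.
  by apply: map_f; rewrite mem_enum.
have -> : zspan (range (b \o f)) = S.
  apply/seteqP; split=> x.
    move=> [k [v [c [vf ->]]]] j fj; rewrite co_sum big1// => i _.
    by have [i' _ <-] := vf i; rewrite coZ /= cob (negPf (fj i')) mulr0.
  by move=> Sx; exists l, (b \o f), (\row_i co x (f i)); split=> //; exact: SE.
have subS : submodule S.
  split=> [j _|x y Sx Sy j fj]; first exact: co0.
  by rewrite coB Sx// Sy// subrr.
split=> //.
  exists (b \o f); split=> [i j fj /=|x Sx]; first by rewrite cob (negPf (fj i)).
  exists (\row_i co x (f i)); split=> [|c xc]; first exact: SE.
  by apply/rowP => i; rewrite mxE xc co_comb.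
exists [set x | forall i, co x (f i) = 0]; split=> [|x].
  by split=> [i|x y Nx Ny i]; rewrite ?co0 ?coB ?Nx ?Ny ?subrr.
pose y := \sum_(i < l) (\row_i co x (f i)) 0 i *: b (f i).
exists (y, x - y); split=> [|[p q] /= [Sp Nq xpq]].
  split=> /=; last by rewrite subrKC.
    by move=> j fj; exact: co_comb0.
  by move=> i; rewrite coB co_comb mxE subrr.
have -> : y = p.
  rewrite (SE p Sp) /y; apply: eq_bigr => i _; rewrite !mxE.
  by rewrite xpq coD Nq addr0.
by rewrite xpq addrAC subrr add0r.
Qed.

(** The representative is known only up to sign; keeping the sign as an integer factor lets spans
    absorb it. *)
Lemma repr_zpm_cases (x : zpm m) (y : Z) : x = \pi_(zpm m) y ->
  exists e : int, y = e *: repr x.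
Proof.
move=> xy; have /zpm_eqP[->|->] : \pi_(zpm m) (repr x) = \pi_(zpm m) y.
- by rewrite reprK.
- by exists 1; rewrite scale1r.
by exists (-1); rewrite scaleN1r opprK.
Qed.

End LatticeBases.

Lemma append0_linear m (x y : 'rV[int]_m.+1.-1) (a : int) :
  @append0 m.+1 (a *: x + y) = a *: @append0 m.+1 x + @append0 m.+1 y.
Proof.
apply/rowP => i; rewrite !mxE; case: insub => [j|]; last by rewrite mulr0 addr0.
by rewrite !mxE.
Qed.

Lemma append0_widen m (x : 'rV[int]_m) (i : 'I_m) :
  @append0 m.+1 x 0 (widen_ord (leqnSn m) i) = x 0 i.
Proof.
rewrite mxE insubT /=; first exact: ltn_ord.
by move=> im; congr (x 0 _); apply: val_inj.
Qed.

Lemma append0_max m (x : 'rV[int]_m) : @append0 m.+1 x 0 ord_max = 0.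
Proof. by rewrite mxE insubF //= ltnn. Qed.

(** A vector splits into its first [m] coordinates and a multiple of [e_last]. The unknown signs go
    into the coefficients. *)
Lemma append0_unitmx m (b' : 'I_m -> 'rV[int]_m) (b : 'I_m.+1 -> 'rV[int]_m.+1) :
  has_zbasis setT b' ->
  (forall i, exists e : int,
     @append0 m.+1 (b' i) = e *: b (widen_ord (leqnSn m) i)) ->
  (exists e : int, e_last m.+1 = e *: b ord_max) ->
  \matrix_i b i \in unitmx.
Proof.
move=> [_ b'B] /choice[e eE] [el elE]; apply: spanning_unitmx => x.
pose x' : 'rV[int]_m := \row_i x 0 (widen_ord (leqnSn m) i).
have [c [x'c _]] := b'B x' Logic.I.
exists (\row_i (if insub (i : nat) is Some j then c 0 j * e j else x 0 ord_max * el)).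
rewrite big_ord_recr /= mxE insubF /=; last by rewrite ltnn.
rewrite -scalerA -elE.
have xE : x = @append0 m.+1 x' + x 0 ord_max *: e_last m.+1.
  apply/rowP => i; rewrite mxE; have [im|im] := ltnP i m.
    have -> : i = widen_ord (leqnSn m) (Ordinal im) by apply: val_inj.
    by rewrite append0_widen !mxE /= (ltn_eqF im) mulr0 addr0.
  have -> : i = ord_max by apply: val_inj => /=; have := ltn_ord i; lia.
  by rewrite append0_max !mxE /= eqxx mulr1 add0r.
rewrite [LHS]xE; congr (_ + _).
have -> : @append0 m.+1 x' = \sum_(i < m) c 0 i *: @append0 m.+1 (b' i).
  rewrite x'c; elim/big_rec2: _ => [|i y z _ <-]; last by rewrite append0_linear.
  by apply/rowP => i; rewrite !mxE; case: insub => // j; rewrite mxE.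
apply: eq_bigr => i _; rewrite eE scalerA; congr (_ *: _); rewrite mxE /=.
by rewrite insubT //= => im; congr (c 0 _ * e _); apply: val_inj.
Qed.

(** * Integer spans and dropping the last coordinate *)

Section IntegerSpan.
Context {m : nat}.
Local Notation Z := 'rV[int]_m.
Implicit Types (A : set Z) (x y : Z).

Lemma zspan0 A : zspan A 0.
Proof.
exists 0%N, (fun=> 0), 0; split=> [[]//|]; by rewrite big_ord0.
Qed.

Lemma zspan_gen A x : A x -> zspan A x.
Proof.
move=> Ax; exists 1%N, (fun=> x), (const_mx 1); split=> //.
by rewrite big_ord1 mxE scale1r.
Qed.

Lemma zspanD A x y : zspan A x -> zspan A y -> zspan A (x + y).
Proof.
move=> [k [v [c [Av ->]]]] [l [w [d [Aw ->]]]].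
exists (k + l)%N,
  (fun i => match fintype.split i with inl i1 => v i1 | inr i2 => w i2 end), (row_mx c d).
split=> [i|]; first by case: fintype.split.
rewrite big_split_ord; congr (_ + _); apply: eq_bigr => i _.
  by rewrite row_mxEl (unsplitK (inl i)).
by rewrite row_mxEr (unsplitK (inr i)).
Qed.

Lemma zspanZ A a x : zspan A x -> zspan A (a *: x).
Proof.
move=> [k [v [c [Av ->]]]]; exists k, v, (a *: c); split=> //.
by rewrite scaler_sumr; apply: eq_bigr => i _; rewrite mxE scalerA.
Qed.

Lemma zspan_sub A (S : set Z) : S 0 -> (forall x y, S x -> S y -> S (x + y)) ->
  (forall a x, S x -> S (a *: x)) -> A `<=` S -> zspan A `<=` S.
Proof.
move=> S0 SD SZ AS x [k [v [c [Av ->]]]].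
by elim/big_ind: _ => // i _; apply: SZ; exact/AS/Av.
Qed.

End IntegerSpan.

Definition restrict_last (T : Type) m (x : 'rV[T]_m.+1) : 'rV[T]_m :=
  \row_i x 0 (widen_ord (leqnSn m) i).

Lemma restrict_last0 (T : nmodType) m : @restrict_last T m 0 = 0.
Proof. by apply/rowP => i; rewrite !mxE. Qed.

Lemma restrict_lastD (T : nmodType) m (x y : 'rV[T]_m.+1) :
  restrict_last (x + y) = restrict_last x + restrict_last y.
Proof. by apply/rowP => i; rewrite !mxE. Qed.

Lemma restrict_lastZ (T : pzRingType) m a (x : 'rV[T]_m.+1) :
  restrict_last (a *: x) = a *: restrict_last x.
Proof. by apply/rowP => i; rewrite !mxE. Qed.

Lemma restrict_last_append0 m (x : 'rV[int]_m) : restrict_last (@append0 m.+1 x) = x.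
Proof. by apply/rowP => i; rewrite mxE append0_widen. Qed.

(** * The projection between tori and its section *)

Section TorusMaps.
Context {R : realType} {m : nat}.

Definition append0R (x : 'rV[R]_m) : 'rV[R]_m.+1 :=
  \row_i (if insub (i : nat) is Some j then x 0 j else 0).

Lemma append0RK : cancel append0R (@restrict_last R m).
Proof.
move=> x; apply/rowP => i; rewrite !mxE insubT /=; first exact: ltn_ord.
by move=> im; congr (x 0 _); apply: val_inj.
Qed.

Lemma matrix_continuous (X : topologicalType) p q (f : X -> 'M[R]_(p, q)) :
  (forall i j, continuous (fun x => f x i j)) -> continuous f.
Proof.
move=> fc x A [P MP PA].
have : nbhs x (fun y => forall i j, P i j (f y i j)).
  by apply: filter_forall => i; apply: filter_forall => j; exact/fc/MP.
by apply: filterS => y; exact: PA.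
Qed.

Lemma restrict_last_continuous : continuous (@restrict_last R m).
Proof.
apply: matrix_continuous => i j.
rewrite (_ : (fun x : 'rV[R]_m.+1 => restrict_last x i j) =
             (fun x : 'rV[R]_m.+1 => x 0 (widen_ord (leqnSn m) j))).
  exact: coord_continuous.
by apply/funext => x; rewrite mxE.
Qed.

Lemma append0R_continuous : continuous append0R.
Proof.
apply: matrix_continuous => i j; rewrite /append0R.
rewrite (_ : (fun _ => _) = (fun x : 'rV[R]_m =>
  if insub (j : nat) is Some k then x 0 k else 0)); last first.
  by apply/funext => x; rewrite mxE.
by case: insub => [k|]; [exact: coord_continuous|exact: cst_continuous].
Qed.

Lemma pi_torus_repr k (x : 'rV[R]_k) : x - repr (\pi_(torus R k) x) \is a mxOver Num.int.
Proof. by apply/pi_torus_eq; rewrite reprK. Qed.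

Lemma pi_torus0 k : \pi_(torus R k) 0 = 0.
Proof. by apply: (@addrI _ (\pi_(torus R k) 0)); rewrite -pi_torusD !addr0. Qed.

Lemma pi_torusB k (x y : 'rV[R]_k) :
  \pi_(torus R k) (x - y) = \pi_(torus R k) x - \pi_(torus R k) y.
Proof. by apply/eqP; rewrite eq_sym subr_eq -pi_torusD subrK. Qed.

(** Defined on chosen representatives; [torus_proj_pi] removes the choice, because dropping a
    coordinate preserves integer vectors. *)
Definition torus_proj (t : torus R m.+1) : torus R m :=
  \pi_(torus R m) (restrict_last (repr t)).

Definition torus_incl (t : torus R m) : torus R m.+1 :=
  \pi_(torus R m.+1) (append0R (repr t)).

Lemma torus_proj_pi x : torus_proj (\pi_(torus R m.+1) x) = \pi_(torus R m) (restrict_last x).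
Proof.
apply/esym/pi_torus_eq/mxOverP => i j; have /mxOverP/(_ 0 (widen_ord (leqnSn m) j)) := pi_torus_repr x.
by rewrite !mxE.
Qed.

Lemma torus_incl_pi x : torus_incl (\pi_(torus R m) x) = \pi_(torus R m.+1) (append0R x).
Proof.
apply/esym/pi_torus_eq/mxOverP => i j; have /mxOverP := pi_torus_repr x.
rewrite !mxE; case: insub => [k|]; last by rewrite subr0 rpred0.
by move=> /(_ 0 k); rewrite !mxE.
Qed.

Lemma torus_proj_continuous : continuous torus_proj.
Proof.
apply/quotient_continuous.
rewrite (_ : _ \o _ = \pi_(torus R m) \o @restrict_last R m); last first.
  by apply/funext => x; exact: torus_proj_pi.
move=> x; apply: continuous_comp; first exact: restrict_last_continuous.
exact: pi_continuous.
Qed.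

Lemma torus_incl_continuous : continuous torus_incl.
Proof.
apply/quotient_continuous.
rewrite (_ : _ \o _ = \pi_(torus R m.+1) \o append0R); last first.
  by apply/funext => x; exact: torus_incl_pi.
move=> x; apply: continuous_comp; first exact: append0R_continuous.
exact: pi_continuous.
Qed.

Lemma torus_inclK : cancel torus_incl torus_proj.
Proof. by move=> t; rewrite torus_proj_pi append0RK reprK. Qed.

Lemma torus_projB t u : torus_proj (t - u) = torus_proj t - torus_proj u.
Proof.
rewrite -(reprK t) -(reprK u) -pi_torusB !torus_proj_pi -pi_torusB.
by congr (\pi_(torus R m) _); apply/rowP => i; rewrite !mxE.
Qed.

Lemma torus_inclB t u : torus_incl (t - u) = torus_incl t - torus_incl u.
Proof.
rewrite -(reprK t) -(reprK u) -pi_torusB !torus_incl_pi -pi_torusB.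
congr (\pi_(torus R m.+1) _); apply/rowP => i; rewrite !mxE.
by case: insub => [j|]; rewrite ?mxE ?subr0.
Qed.

Lemma subtorus_proj (A : set 'rV[int]_m.+1) (B : set 'rV[int]_m) t :
  (forall x, A x -> B (restrict_last x)) -> subtorus A t -> subtorus B (torus_proj t).
Proof.
move=> AB [k [v [c [Av ->]]]]; exists k, (@restrict_last int m \o v), c.
split=> [i|]; first exact: AB.
rewrite torus_proj_pi; congr (\pi_(torus R m) _); apply/rowP => j.
by rewrite !mxE !summxE; apply: eq_bigr => i _; rewrite !mxE.
Qed.

Lemma subtorus_incl (A : set 'rV[int]_m) (B : set 'rV[int]_m.+1) t :
  (forall x, A x -> B (@append0 m.+1 x)) -> subtorus A t -> subtorus B (torus_incl t).
Proof.
move=> AB [k [v [c [Av ->]]]]; exists k, (@append0 m.+1 \o v), c.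
split=> [i|]; first exact: AB.
rewrite torus_incl_pi; congr (\pi_(torus R m.+1) _); apply/rowP => j.
rewrite !mxE !summxE; case E : (insub _) => [j'|]; rewrite ?summxE; last first.
  by rewrite big1// => i _; rewrite !mxE E mulr0.
by apply: eq_bigr => i _; rewrite !mxE E.
Qed.

Lemma torus_proj_circle (t : torus R m.+1) : last_circle t -> torus_proj t = 0.
Proof.
move=> [k [v [c [Av ->]]]]; rewrite torus_proj_pi -pi_torus0.
congr (\pi_(torus R m) _); apply/rowP => j; rewrite !mxE summxE big1// => i _.
by rewrite !mxE Av ?mulr0//=.
Qed.

Lemma torus_incl_proj_circle (t : torus R m.+1) :
  last_circle (t - torus_incl (torus_proj t)).
Proof.
rewrite -(reprK t); move: (repr t) => x; rewrite torus_proj_pi torus_incl_pi -pi_torusB.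
(* What remains of [x] is its last coordinate times [e_last]. *)
exists 1%N, (fun=> e_last m.+1), (const_mx (x 0 ord_max)); split.
  by move=> _ i im; rewrite mxE (ltn_eqF im).
congr (\pi_(torus R m.+1) _); apply/rowP => i; rewrite big_ord1 !mxE.
have [im|im] := ltnP i m.
  rewrite (insubT (fun i => i < m)%N im) /= mxE (ltn_eqF im) mulr0.
  rewrite (_ : widen_ord _ _ = i) ?subrr//; exact: val_inj.
have -> : i = ord_max by apply: val_inj => /=; have := ltn_ord i; lia.
by rewrite insubF /= ?ltnn// eqxx subr0 mulr1.
Qed.

End TorusMaps.

(** * Maps out of quotient spaces *)

Section QuotientMaps.
Variables (X : topologicalType) (r : X -> X -> Prop) (Y : topologicalType) (f : X -> Y).
Hypothesis fr : forall x y, r x y -> f x = f y.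

Definition quot_lift (x : quot_space r) : Y := f (repr x).

Lemma quot_space_invariant x y : \pi_(quot_space r) x = \pi_(quot_space r) y -> f x = f y.
Proof.
by move=> /quot_space_eqP; elim=> {x y} [x y /fr//|//|x y _ ->//|x y z _ -> _ ->].
Qed.

Lemma quot_lift_pi x : quot_lift (\pi_(quot_space r) x) = f x.
Proof. by apply: quot_space_invariant; rewrite reprK. Qed.

Lemma quot_lift_continuous : continuous f -> continuous quot_lift.
Proof.
move=> fc; apply/quotient_continuous.
rewrite (_ : _ \o _ = f) //; apply/funext => x; exact: quot_lift_pi.
Qed.

End QuotientMaps.

(** * The homeomorphism, given compatibility of the two relations *)

Section OrbitSpace.
Context {R : realType} {m : nat}.
Local Notation V := 'rV[R]_m.+1.
Variables (P Q : set V) (lambda : set V -> zpm m) (eta : set V -> zpm m.+1).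
Local Notation Wrel := (@W_rel R m.+1 P Q lambda).
Local Notation Mrel := (@M_rel R m.+1 Q eta).
Hypotheses
  (WM : forall t u p, Wrel (t, p) (u, p) ->
     Mrel (torus_incl t, p) (torus_incl u, p))
  (MW : forall t u p, Mrel (t, p) (u, p) ->
     Wrel (torus_proj t, p) (torus_proj u, p)).

Local Notation W := (quot_space Wrel).
Local Notation M := (quot_space Mrel).
Let orbit_rel (x y : M) := exists s, last_circle s /\ y = @quasitoric_act R m.+1 Q eta s x.
Local Notation O := (quot_space orbit_rel).

Let to_orbit (x : torus R m * Q) : O :=
  \pi_O (\pi_M (torus_incl x.1, x.2)).

Let from_manifold (x : torus R m.+1 * Q) : W := \pi_W (torus_proj x.1, x.2).

Let to_orbitP x y : Wrel x y -> to_orbit x = to_orbit y.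
Proof.
move: x y => [t p] [u q] tu; have [/= E _] := tu; rewrite -{}E in tu *.
by congr (\pi_O _); apply/quot_space_eqP/rst_step/WM.
Qed.

Let from_manifoldP x y : Mrel x y -> from_manifold x = from_manifold y.
Proof.
move: x y => [t p] [u q] tu; have [/= E _] := tu; rewrite -{}E in tu *.
exact/quot_space_eqP/rst_step/MW.
Qed.

Let from_orbitP x y : orbit_rel x y ->
  quot_lift from_manifold x = quot_lift from_manifold y.
Proof.
move=> [s [sc ->]]; rewrite -(reprK x); case: (repr x) => t p.
have -> := @quasitoric_actE R m.+1 Q eta s t p.
rewrite /quasitoric_class !(quot_lift_pi from_manifoldP) /from_manifold /=.
congr (\pi_W (_, _)); have := torus_projB (s + t) t.
rewrite addrK torus_proj_circle// => /esym/eqP.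
by rewrite subr_eq0 => /eqP ->.
Qed.

Let to_orbit_continuous : continuous to_orbit.
Proof.
have c1 : continuous (fun x : torus R m * Q => (torus_incl x.1, x.2)).
  move=> x; have c : {for x, continuous (fun x => torus_incl x.1)}.
    apply: (@continuous_comp _ _ _ fst torus_incl x); first exact: cvg_fst.
    exact: torus_incl_continuous.
  exact: (cvg_pair c cvg_snd).
move=> x; apply: (@continuous_comp _ _ _ (fun x => \pi_M (torus_incl x.1, x.2))).
  apply: (@continuous_comp _ _ _ (fun x => (torus_incl x.1, x.2)) \pi_M); first exact: c1.
  exact: pi_continuous.
exact: pi_continuous.
Qed.

Let from_manifold_continuous : continuous from_manifold.
Proof.
have c1 : continuous (fun x : torus R m.+1 * Q => (torus_proj x.1, x.2)).
  move=> x; have c : {for x, continuous (fun x => torus_proj x.1)}.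
    apply: (@continuous_comp _ _ _ fst torus_proj x); first exact: cvg_fst.
    exact: torus_proj_continuous.
  exact: (cvg_pair c cvg_snd).
move=> x; apply: (@continuous_comp _ _ _ (fun x => (torus_proj x.1, x.2)) \pi_W); first exact: c1.
exact: pi_continuous.
Qed.

Lemma W_space_homeomorphic_orbit_space :
  homeomorphic (@W_space R m.+1 P Q lambda)
    (@quasitoric_orbit_space R m.+1 Q eta last_circle).
Proof.
exists (quot_lift to_orbit), (quot_lift (quot_lift from_manifold)); split.
- exact: quot_lift_continuous.
- by apply: quot_lift_continuous => //; exact: quot_lift_continuous.
- move=> x; rewrite -(reprK (x : W)); case: (repr _) => t p.
  rewrite (quot_lift_pi to_orbitP) (quot_lift_pi from_orbitP) (quot_lift_pi from_manifoldP).
  by rewrite /from_manifold /= torus_inclK.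
move=> x; rewrite -(reprK (x : O)) -(reprK (repr (x : O))); case: (repr (repr _)) => t p.
rewrite (quot_lift_pi from_orbitP) (quot_lift_pi from_manifoldP) /from_manifold /=.
rewrite (quot_lift_pi to_orbitP) /to_orbit /=.
(* The round trip changes [t] by an element of the circle, so it stays in the same orbit. *)
apply/quot_space_eqP/rst_step; exists (t - torus_incl (torus_proj t)).
split; first exact: torus_incl_proj_circle.
have -> := @quasitoric_actE R m.+1 Q eta (t - torus_incl (torus_proj t)) _ p.
by rewrite subrK.
Qed.

End OrbitSpace.

(** * The characteristic function on the cut polytope *)

Section CutPolytope.
Context {R : realType} {m : nat}.
Local Notation n := m.+1.
Local Notation V := 'rV[R]_n.
Variables (s : seq (V * R)) (H : V -> V * R) (vs : seq V).
Local Notation P := (polyhedron s).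
Hypotheses (irs : irredundant s) (m_gt1 : (1 < m)%N) (esP : edge_simple P)
  (HP : vertex_cut P H) (uvs : uniq vs)
  (vsP : forall v, vertex P v <-> v \in vs).
Variable (lambda : set V -> zpm n.-1).
Hypothesis lambdaP : isotropy_function P lambda.
Local Notation Q := (polyhedron (cut_forms s H vs)).
Implicit Types (x v : V) (h : V * R).

Let n_gt1 : (1 < n)%N. Proof. exact: ltnW. Qed.
Let bP : bounded_set P. Proof. by case: esP => -[]. Qed.
Let bQ : bounded_set Q.
Proof.
move: bP => [M [Mr MA]]; exists M; split=> // r Mr' x Qx.
by apply: MA => //; exact: (cut_subset vsP Qx).
Qed.
Let irQ : irredundant (cut_forms s H vs). Proof. exact: cut_irredundant. Qed.

Let cut_facet h : h \in s -> Q `&` hyperplane h = P `&` hyperplane h `&` Q.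
Proof.
move=> hs; apply/seteqP; split=> x [].
  by move=> Qx xh; do ![split] => //; exact: (cut_subset vsP Qx).
by move=> [_ xh] Qx.
Qed.

Let mem_cut_forms h : h \in cut_forms s H vs <->
  h \in s \/ exists2 v, vertex P v & h = H v.
Proof.
rewrite mem_cat; split=> [/orP[|/mapP[v /vsP vv ->]]|[->//|[v /vsP vv ->]]].
- by left.
- by right; exists v.
by rewrite map_f ?orbT.
Qed.

Lemma simple_cut_polytope : simple_polytope Q.
Proof.
have [_ [c sc] _] := irQ; split; [split=> //; by exists (cut_forms s H vs)| |].
  exact: has_dim_interior sc.
move=> x vx; have [dx [v vv tv]] := cut_vertex irs n_gt1 bP HP uvs vsP vx.
have Qx : Q x by case/vertexP: vx.
have := card_facets_at irQ (ltn0Sn m) Qx; rewrite tv size_rcons.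
by rewrite (size_tight_edge irs _ esP (cut_subset vsP Qx) dx).
Qed.

Lemma facet_cut_polytope :
  facet Q = [set F `&` Q | F in facet P] `|`
            [set P `&` hyperplane (H v) | v in vertex P].
Proof.
apply/seteqP; split=> G.
  move=> /(facet_polyhedronP _ irQ (ltn0Sn m))[h hQ ->].
  have [hs|[v vv ->]] := (mem_cut_forms h).1 hQ.
    left; exists (P `&` hyperplane h); last by rewrite cut_facet.
    by apply/(facet_polyhedronP _ irs (ltn0Sn m)); exists h.
  by right; exists v => //; rewrite (cut_hyperplane irs n_gt1 bP HP vsP).
move=> [[F /(facet_polyhedronP _ irs (ltn0Sn m))[h hs ->] <-]|[v vv <-]];
  apply/(facet_polyhedronP _ irQ (ltn0Sn m)).
  by exists h; [apply/mem_cut_forms; left|rewrite cut_facet].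
exists (H v); first by apply/mem_cut_forms; right; exists v.
by rewrite (cut_hyperplane irs n_gt1 bP HP vsP).
Qed.

Definition eta_spec (eta : set V -> zpm n) :=
  (forall v, vertex P v ->
     eta (P `&` hyperplane (H v)) = \pi_(zpm n) (e_last n)) /\
  (forall F, facet P F -> eta (F `&` Q) = zpm_append0 (lambda F)).

Lemma exists_eta : exists eta, eta_spec eta.
Proof.
pose p G h := h \in cut_forms s H vs /\ G = Q `&` hyperplane h.
(* [xget] recovers the constraint defining a facet, unique by [facet_inj]; the default [(0, 0)] only
   matters at sets that are not facets. *)
pose eta G := let h := xget (0, 0) (p G) in
  if h \in s then zpm_append0 (lambda (P `&` hyperplane h)) else \pi_(zpm n) (e_last n).
have pE h : h \in cut_forms s H vs -> xget (0, 0) (p (Q `&` hyperplane h)) = h.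
  move=> hQ; case: xgetP => [k _ [kQ E]|/(_ h)[]//].
  by apply: (facet_inj irQ).
exists eta; split=> [v vv|F].
  have hQ : H v \in cut_forms s H vs by apply/mem_cut_forms; right; exists v.
  rewrite (cut_hyperplane irs n_gt1 bP HP vsP vv) /eta pE// ifF//.
  apply/negP => hs; have [uQ _ _] := irQ; move: uQ; rewrite cat_uniq.
  by move=> /and3P[_ /hasPn/(_ _ (map_f H ((vsP v).1 vv))) + _]; rewrite /= hs.
move=> /(facet_polyhedronP _ irs (ltn0Sn m))[h hs ->].
by rewrite -cut_facet// /eta pE ?hs//; apply/mem_cut_forms; left.
Qed.

Section WithEta.
Variable eta : set V -> zpm n.
Hypothesis etaP : eta_spec eta.

Let eta_facet h : h \in s ->
  eta (Q `&` hyperplane h) = \pi_(zpm n) (append0 (repr (lambda (P `&` hyperplane h)))).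
Proof.
move=> hs; rewrite cut_facet// etaP.2//.
by apply/(facet_polyhedronP _ irs (ltn0Sn m)); exists h.
Qed.

Let eta_cut v : vertex P v -> eta (Q `&` hyperplane (H v)) = \pi_(zpm n) (e_last n).
Proof. by move=> vv; rewrite -(cut_hyperplane irs n_gt1 bP HP vsP vv) etaP.1. Qed.

Lemma isotropy_zbasis x (k : 'I_m -> V * R) : P x -> \dim (lin (tight s x)) = 1%N ->
  injective k -> (forall h, h \in tight s x <-> exists i, k i = h) ->
  has_zbasis setT (fun i => repr (lambda (P `&` hyperplane (k i)))).
Proof.
move=> Px dx kinj kx; pose Fs i := P `&` hyperplane (k i).
have ks i : k i \in s.
  have : k i \in tight s x by apply/kx; exists i.
  by rewrite mem_tight => /andP[].
apply: (lambdaP (Fs := Fs)).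
- by move=> i j E; apply/kinj/(facet_inj irs).
- by move=> i; apply/(facet_polyhedronP _ irs (ltn0Sn m)); exists (k i).
have -> : \bigcap_i Fs i = min_face s x; last exact: edge_min_face.
rewrite (min_face_bigcap Px kx) setIidr// => y yF.
(* The family is nonempty because [m > 0], so its intersection lies in [P]. *)
by have [] := yF (Ordinal (ltnW m_gt1)) Logic.I.
Qed.

Lemma characteristic_cut_polytope : characteristic_function Q eta.
Proof.
move=> l G Ginj GF [x xG].
have /choice[h hG] i : exists h, h \in cut_forms s H vs /\ G i = Q `&` hyperplane h.
  by have [h hQ ->] := (facet_polyhedronP _ irQ (ltn0Sn m)).1 (GF i); exists h.
(* For [l = 0] the given point may lie outside [Q], since an empty intersection is the whole space;
   an interior point replaces it. *)
have {x xG} [x Qx xG] : exists2 x, Q x & forall i, G i x.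
  have [l0|l0] := posnP l.
    have [_ [c sc] _] := irQ; exists c => [k kQ|k]; first by apply: ltW; exact: sc.
    by exfalso; have := ltn_ord k; lia.
  exists x => [|i]; last exact: xG.
  by have := xG (Ordinal l0) Logic.I; rewrite (hG _).2 => -[].
have hx i : h i \in tight (cut_forms s H vs) x.
  rewrite mem_tight (hG i).1 andbT; apply/eqP.
  by have := xG i; rewrite (hG i).2 => -[].
have [p [vp xp _]] := vertex_below 0 bQ Qx.
have [dp [v vv tv]] := cut_vertex irs n_gt1 bP HP uvs vsP vp.
have Qp : Q p by case/vertexP: vp.
have Pp := cut_subset vsP Qp.
have sp : size (tight s p) = m := size_tight_edge irs n_gt1 esP Pp dp.
have utp : uniq (tight s p) by apply: filter_uniq; case: irs.
(* The cut is listed last so that it matches the last coordinate of [e_last]. *)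
pose L := rcons (tight s p) (H v); have sL : size L = n by rewrite size_rcons sp.
have hL i : h i \in L by rewrite /L -tv xp.
have iL i : (index (h i) L < n)%N by rewrite -[ltnRHS]sL index_mem.
pose f i := Ordinal (iL i).
have finj : injective f.
  move=> i j /(congr1 val) /= /(congr1 (nth (0, 0) L)); rewrite !nth_index// => E.
  by apply: Ginj; rewrite (hG i).2 (hG j).2 E.
pose b (i : 'I_n) := repr (eta (Q `&` hyperplane (nth (0, 0) L i))).
have -> : (fun i => repr (eta (G i))) = b \o f.
  by apply/funext => i; rewrite /b /= nth_index// (hG i).2.
suff ub : \matrix_i b i \in unitmx by exact: (unitmx_direct_summand finj ub).
pose k (i : 'I_m) := nth (0, 0) (tight s p) i.
have kt i : k i \in tight s p by rewrite mem_nth// sp.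
have ks i : k i \in s by have := kt i; rewrite mem_tight => /andP[].
apply: (@append0_unitmx m (fun i => repr (lambda (P `&` hyperplane (k i))))).
- apply: isotropy_zbasis dp _ _ => // [i j /eqP|g].
    by rewrite nth_uniq ?sp// => /eqP/val_inj.
  split=> [gt|[i <-]//].
  have ig : (index g (tight s p) < m)%N by rewrite -[ltnRHS]sp index_mem.
  by exists (Ordinal ig); rewrite /k /= nth_index.
- move=> i; apply: repr_zpm_cases; rewrite -eta_facet//; congr (eta (_ `&` hyperplane _)).
  by rewrite /= nth_rcons sp ltn_ord.
apply: repr_zpm_cases; rewrite -(eta_cut vv); congr (eta (_ `&` hyperplane _)).
by rewrite /= nth_rcons sp ltnn eqxx.
Qed.

(** [face_torus] asks for as many facets as the codimension of the face. The active constraints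
    provide them by [dim_lin_tight], as [x] is not a vertex of [P]. *)
Lemma face_torus_min_face x (t : torus R n.-1) : Q x ->
  subtorus (zspan [set repr (lambda (P `&` hyperplane h)) | h in [set` tight s x]]) t ->
  face_torus P lambda (min_face s x) t.
Proof.
move=> Qx tx; have Px := cut_subset vsP Qx.
have L0 := cut_not_vertex HP vsP Qx.
have := dim_lin_tight irs n_gt1 esP Px L0.
have : (0 < \dim (lin (tight s x)))%N by rewrite lt0n dimv_eq0; apply/eqP.
have utx : uniq (tight s x) by apply: filter_uniq; case: irs.
pose k (i : 'I_(size (tight s x))) := tnth (in_tuple (tight s x)) i.
have kt i : k i \in tight s x by apply: mem_tnth.
have ks i : k i \in s by have := kt i; rewrite mem_tight => /andP[].
have kx h : h \in tight s x <-> exists i, k i = h.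
  by split=> [/seq_tnthP[i ->]|[i <-]//]; exists i.
move=> d0 dn; exists (size (tight s x)), (fun i => P `&` hyperplane (k i)); split.
- by rewrite -[ltnRHS]dn -[ltnLHS]add0n ltn_add2r.
- have /tuple_uniqP kinj : uniq (in_tuple (tight s x)) by [].
  by move=> i j E; apply: kinj; exact: (facet_inj irs).
- by move=> i; apply/(facet_polyhedronP _ irs (ltn0Sn m)); exists (k i).
- split; first exact: min_face_bigcap.
  by rewrite -[X in (X - _)%N]dn addnK; exact: has_dim_min_face.
move: tx; congr (subtorus (zspan _) t); apply/seteqP; split=> [_ [h /= /kx[i <-] <-]|_ [i _ <-]].
  by exists i.
by exists (k i) => /=.
Qed.

(** The facets of [P] cutting out [F] contain [p], so their traces are facets of [Q] through [p],
    with value [(lambda, 0)] up to sign. *)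
Lemma W_rel_M_rel t u (p : Q) : @W_rel R n P Q lambda (t, p) (u, p) ->
  @M_rel R n Q eta (torus_incl t, p) (torus_incl u, p).
Proof.
move=> [_ [F /= [fF [Fp _] [l [Fs [_ _ Fsf [FE _] tu]]]]]]; split=> //=.
rewrite -torus_inclB; apply: subtorus_incl tu.
have a0 : @append0 n 0 = 0 by apply/rowP => i; rewrite !mxE; case: insub => // j; rewrite mxE.
have aD (x y : 'rV[int]_m) : @append0 n (x + y) = @append0 n x + @append0 n y.
  by have := append0_linear x y 1; rewrite !scale1r.
apply: (zspan_sub (S := [set x | zspan _ (@append0 n x)])) => [|x y|a x|x].
- by rewrite /= a0; exact: zspan0.
- by rewrite /= aD; exact: zspanD.
- by rewrite /= -[a *: x]addr0 append0_linear a0 addr0; exact: zspanZ.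
move=> [i _ <-]; have [h hs hE] := (facet_polyhedronP _ irs (ltn0Sn m)).1 (Fsf i).
rewrite hE /=; have [e ->] := repr_zpm_cases (eta_facet hs).
apply: zspanZ; apply: zspan_gen; exists (Q `&` hyperplane h) => //; split.
  by apply/(facet_polyhedronP _ irQ (ltn0Sn m)); exists h => //; apply/mem_cut_forms; left.
split; first exact: set_valP.
by move: Fp; rewrite FE => -[_ /(_ i Logic.I)]; rewrite hE => -[].
Qed.

(** A facet of [Q] through [p] is either the trace of a facet of [P] active at [p], whose value
    projects to [lambda] up to sign, or a cut, whose value projects to 0. *)
Lemma M_rel_W_rel t u (p : Q) : @M_rel R n Q eta (t, p) (u, p) ->
  @W_rel R n P Q lambda (torus_proj t, p) (torus_proj u, p).
Proof.
move=> [_ /= tu]; split=> //=; have Qp : Q (val p) by exact: set_valP.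
have Pp := cut_subset vsP Qp.
exists (min_face s (val p)); split; [exact: face_min_face|exact: relint_min_face|].
apply: face_torus_min_face => //; rewrite -torus_projB; apply: subtorus_proj tu.
apply: (zspan_sub (S := [set x | zspan _ (restrict_last x)])) => [|x y|a x|x].
- by rewrite /= restrict_last0; exact: zspan0.
- by rewrite /= restrict_lastD; exact: zspanD.
- by rewrite /= restrict_lastZ; exact: zspanZ.
move=> [G [/(facet_polyhedronP _ irQ (ltn0Sn m))[h hQ GE] Gp] <-].
move: Gp; rewrite {}GE => -[_ hp].
have [hs|[v vv hE]] := (mem_cut_forms h).1 hQ.
  have /zpm_eqP E : \pi_(zpm n) (repr (eta (Q `&` hyperplane h))) =
      \pi_(zpm n) (append0 (repr (lambda (P `&` hyperplane h)))).
    by rewrite reprK eta_facet.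
  have ht : h \in tight s (val p) by rewrite mem_tight hs andbT; apply/eqP.
  have Ah : zspan [set repr (lambda (P `&` hyperplane k)) | k in [set` tight s (val p)]]
      (repr (lambda (P `&` hyperplane h))) by apply: zspan_gen; exists h.
  rewrite /=; case: E => ->; first by rewrite restrict_last_append0.
  by rewrite -scaleN1r restrict_lastZ restrict_last_append0; exact: zspanZ.
have /zpm_eqP E : \pi_(zpm n) (repr (eta (Q `&` hyperplane h))) = \pi_(zpm n) (e_last n).
  by rewrite reprK hE eta_cut.
have re : restrict_last (e_last n) = 0 :> 'rV[int]_m.
  by apply/rowP => i; rewrite !mxE /= (ltn_eqF (ltn_ord i)).
rewrite /=; case: E => ->; first by rewrite re; exact: zspan0.
by rewrite -scaleN1r restrict_lastZ re scaler0; exact: zspan0.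
Qed.

End WithEta.
End CutPolytope.

Theorem mainTheorem5 (R : realType) (n : nat) (n_gt2 : (2 < n)%N)
    (P : set 'rV[R]_n) (P_edge_simple : edge_simple P)
    (lambda : set 'rV[R]_n -> zpm n.-1) (lambdaP : isotropy_function P lambda)
    (H : 'rV[R]_n -> 'rV[R]_n * R) (HP : vertex_cut P H) :
  let Q := cut_polytope P H in
  let eta_spec (eta : set 'rV[R]_n -> zpm n) :=
    (forall v, vertex P v ->
       eta (P `&` hyperplane (H v)) = \pi_(zpm n) (e_last n)) /\
    (forall F, facet P F -> eta (F `&` Q) = zpm_append0 (lambda F)) in
  [/\ simple_polytope Q,
      facet Q = [set F `&` Q | F in facet P] `|`
                [set P `&` hyperplane (H v) | v in vertex P],
      exists eta, eta_spec eta
    & forall eta, eta_spec eta ->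
        characteristic_function Q eta /\
        homeomorphic (W_space P Q lambda)
                     (quasitoric_orbit_space Q eta last_circle)].
Proof.
(* Writing [n] as [m.+1] makes [n.-1] compute to [m] and turns the bound into [1 < m]. *)
case: n n_gt2 P P_edge_simple lambda lambdaP H HP => // m m_gt1 P esP lambda lambdaP H HP.
have [polP dimP _] := esP.
have [s irs PE] := polytope_irredundant (ltn0Sn m) polP dimP.
subst P; have [vs uvs vsP] := finite_vertices s.
rewrite (cut_polytopeE H vsP) => Q spec; split.
- exact: simple_cut_polytope.
- exact: facet_cut_polytope.
- exact: exists_eta.
move=> eta etaP; split; first exact: (characteristic_cut_polytope irs _ esP HP uvs vsP lambdaP).
apply: W_space_homeomorphic_orbit_space => t u p; first exact: W_rel_M_rel.
exact: M_rel_W_rel.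
Qed.
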